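(* Let $A \geqslant 1$ and let $\alpha,\beta\in\mathbb{R}$ with $\alpha>1$, where $\alpha$ is irrational and of finite type. Then for every $f\in\mathscr{F}_A$ and every integer $N\geqslant 3$, $$ \sum_{\substack{n \leqslant N\\ n \in \mathcal{B}_{\alpha,\beta}}} f(n)=\alpha^{-1}\sum_{n\leqslant N} f(n)+O\!\left(\frac{N\log\log N}{\log N}\right), $$ where the implied constant depends only on $\alpha$ and $A$.
   Context: For $A\geqslant 1$, $\mathscr{F}_A$ denotes the set of (complex-valued) multiplicative functions $f$ such that $|f(p)|\leqslant A$ for all primes $p$ and $\sum_{n\leqslant N}|f(n)|^2\leqslant A^2N$ for all $N\in\mathbb{N}$. The non-homogeneous Beatty sequence is $\mathcal{B}_{\alpha,\beta}=\{n\in\mathbb{N} : n=\lfloor \alpha m+\beta\rfloor \text{ for some } m\in\mathbb{Z}\}$. For an irrational number $\gamma$, its type is $\tau=\sup\{t\in\mathbb{R} : \liminf_{n\to\infty} n^t \|\gamma n\| = 0\}$, where $\|x\|$ denotes the distance from $x$ to the nearest integer; $\gamma$ is of finite type if $\tau<\infty$. *)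

(* Defs.v *)
From Stdlib Require Import Reals Lra Lia ZArith Znumtheory ClassicalEpsilon.
From Coquelicot Require Import Coquelicot.
Open Scope R_scope.

Definition dist_nint (x : R) : R :=
  Rmin (x - IZR (Int_part x)) (IZR (Int_part x) + 1 - x).

Definition liminf_zero (gamma t : R) : Prop :=
  LimInf_seq (fun n : nat => Rpower (INR n) t * dist_nint (gamma * INR n)) = Finite 0.

Definition irrational (gamma : R) : Prop :=
  forall p q : Z, q <> 0%Z -> gamma <> IZR p / IZR q.

(* gamma of finite type: tau = sup {t | liminf n^t ||gamma n|| = 0} < +oo,
   i.e. that set is bounded above (it always contains every t < 1). *)
Definition finite_type (gamma : R) : Prop :=
  exists T : R, forall t : R, liminf_zero gamma t -> t <= T.

Definition multiplicative (f : nat -> C) : Prop :=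
  f 1%nat = 1%C /\
  forall m n : nat, (1 <= m)%nat -> (1 <= n)%nat -> Nat.gcd m n = 1%nat ->
    f (m * n)%nat = (f m * f n)%C.

Fixpoint csum (g : nat -> C) (N : nat) : C :=
  match N with
  | O => 0%C
  | S k => (csum g k + g (S k))%C
  end.

Fixpoint rsum (g : nat -> R) (N : nat) : R :=
  match N with
  | O => 0
  | S k => rsum g k + g (S k)
  end.

Definition in_FA (A : R) (f : nat -> C) : Prop :=
  multiplicative f /\
  (forall p : nat, prime (Z.of_nat p) -> Cmod (f p) <= A) /\
  (forall N : nat, rsum (fun n => (Cmod (f n)) ^ 2) N <= A ^ 2 * INR N).

Definition in_Beatty (alpha beta : R) (n : nat) : Prop :=
  (1 <= n)%nat /\ exists m : Z, Z.of_nat n = Int_part (alpha * IZR m + beta).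

Definition indic (P : Prop) : C :=
  if excluded_middle_informative P then 1%C else 0%C.

(* Main.v *)
(** Multiplying by log N and writing log n as the sum of log p over the primes
    p exactly dividing n turns sum f(n) u(n), for bounded u, into the bilinear sum
    of f(m) f(p) log p u(pm) over pm <= N, up to O(N).  With D a power of log N,
    the ranges p <= D and p > N/D contribute O(N log log N) by Chebyshev's and
    Mertens' upper bounds: this is the whole error term.  For u(n) = 1_B(n) - 1/alpha,
    a difference of two sawtooth functions of n/alpha, the middle range is O(N):
    the sawtooth is replaced by its Fourier polynomial of degree a power of log N,
    and each harmonic is treated by Cauchy-Schwarz in m, the finite type of alpha
    ensuring that k(p - q)/alpha is rarely close to an integer. *)

Require Import Defs.
From Stdlib Require Import Reals Lra Lia ZArith Znumtheory Arith Bool.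
From Stdlib Require Import ClassicalEpsilon Classical.
From Coquelicot Require Import Coquelicot.
Open Scope nat_scope.
Open Scope R_scope.

(** * Finite sums *)

(** The class controls f only at primes and in mean square. Hence [ln n] is built from the primes
    that divide n exactly, where f(pm) = f(p) f(m) holds, and every defect is bounded in mean square
    before being paired with |f|. Both cut-offs serve the bilinear estimate: p > D makes the
    diagonal p = q negligible, and N/p >= D leaves a sum over m long enough to cancel. Finite type
    gives ||alpha n|| >= c / n^t with a fixed exponent t; this is why a fixed power of log N is
    enough for D, so that log D stays of order log log N. Squaring leaves only differences of
    phases, so [beta] disappears and all bounds are uniform in it. All sums are real: the real and
    imaginary parts of f each satisfy a two-term bilinear relation that stands in for
    multiplicativity. *)

Lemma rsum_ext (g h : nat -> R) (N : nat) :
  (forall n, (1 <= n <= N)%nat -> g n = h n) -> rsum g N = rsum h N.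
Proof.
  induction N as [|N IH]; simpl; intros H; [easy|].
  rewrite IH, H; [easy|lia|intros; apply H; lia].
Qed.

Lemma rsum_le (g h : nat -> R) (N : nat) :
  (forall n, (1 <= n <= N)%nat -> g n <= h n) -> rsum g N <= rsum h N.
Proof.
  induction N as [|N IH]; simpl; intros H; [lra|].
  apply Rplus_le_compat; [apply IH; intros; apply H; lia|apply H; lia].
Qed.

Lemma rsum_0 (N : nat) : rsum (fun _ => 0) N = 0.
Proof. induction N; simpl; lra. Qed.

Lemma rsum_nonneg (g : nat -> R) (N : nat) :
  (forall n, (1 <= n <= N)%nat -> 0 <= g n) -> 0 <= rsum g N.
Proof. intros H. rewrite <- (rsum_0 N). now apply rsum_le. Qed.

Lemma rsum_plus (g h : nat -> R) (N : nat) :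
  rsum (fun n => g n + h n) N = rsum g N + rsum h N.
Proof. induction N; simpl; lra. Qed.

Lemma rsum_minus (g h : nat -> R) (N : nat) :
  rsum (fun n => g n - h n) N = rsum g N - rsum h N.
Proof. induction N; simpl; lra. Qed.

Lemma rsum_scal (c : R) (g : nat -> R) (N : nat) :
  rsum (fun n => c * g n) N = c * rsum g N.
Proof. induction N as [|N IH]; simpl; [|rewrite IH]; lra. Qed.

Lemma rsum_scal_r (c : R) (g : nat -> R) (N : nat) :
  rsum (fun n => g n * c) N = rsum g N * c.
Proof. induction N as [|N IH]; simpl; [|rewrite IH]; lra. Qed.

Lemma rsum_const (c : R) (N : nat) : rsum (fun _ => c) N = c * INR N.
Proof. induction N as [|N IH]; [simpl; lra|]. rewrite S_INR; simpl; lra. Qed.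

Lemma rsum_abs (g : nat -> R) (N : nat) :
  Rabs (rsum g N) <= rsum (fun n => Rabs (g n)) N.
Proof.
  induction N as [|N IH]; simpl; [rewrite Rabs_R0; lra|].
  eapply Rle_trans; [apply Rabs_triang|lra].
Qed.

Lemma rsum_swap (F : nat -> nat -> R) (M N : nat) :
  rsum (fun m => rsum (F m) N) M = rsum (fun n => rsum (fun m => F m n) M) N.
Proof.
  induction M as [|M IH]; simpl; [now rewrite rsum_0|].
  now rewrite IH, <- rsum_plus.
Qed.

Lemma rsum_le_extend (g : nat -> R) (M N : nat) :
  (M <= N)%nat -> (forall n, (1 <= n)%nat -> 0 <= g n) -> rsum g M <= rsum g N.
Proof.
  intros H Hg. induction H as [|N H IH]; [lra|].
  simpl. specialize (Hg (S N) ltac:(lia)). lra.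
Qed.

Lemma rsum_truncate (g : nat -> R) (M N : nat) :
  (M <= N)%nat -> rsum (fun n => if n <=? M then g n else 0) N = rsum g M.
Proof.
  intros H. induction H as [|N H IH]; cbn [rsum].
  - apply rsum_ext. intros n Hn. now rewrite (proj2 (Nat.leb_le n M)) by lia.
  - rewrite IH. destruct (Nat.leb_spec (S N) M); [lia|lra].
Qed.

(** Moving the bound m <= N/p into a condition makes both ranges of a double sum over pm <= N equal
    to [1, N], so that the order of summation can be exchanged. *)
Lemma rsum_quot (g : nat -> R) (p N : nat) :
  (1 <= p)%nat ->
  rsum g (N / p) = rsum (fun m => if m * p <=? N then g m else 0) N.
Proof.
  intros Hp. rewrite <- (rsum_truncate g (N / p) N).
  2:{ apply Nat.Div0.div_le_upper_bound. nia. }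
  apply rsum_ext. intros m _.
  pose proof (Nat.Div0.mul_div_le N p) as E.
  destruct (Nat.leb_spec m (N / p)) as [H|H];
    destruct (Nat.leb_spec (m * p) N) as [H'|H']; try easy; exfalso.
  - apply (Nat.mul_le_mono_r _ _ p) in H. lia.
  - assert (m <= N / p)%nat by (apply Nat.div_le_lower_bound; lia). lia.
Qed.

Definition dvd (p n : nat) : bool := n mod p =? 0.

Lemma dvd_spec (p n : nat) : (1 <= p)%nat -> dvd p n = true <-> Nat.divide p n.
Proof.
  intros Hp. unfold dvd. rewrite Nat.eqb_eq. apply Nat.Lcm0.mod_divide.
Qed.

Lemma rsum_multiples (g : nat -> R) (p N : nat) :
  (1 <= p)%nat ->
  rsum (fun n => if dvd p n then g n else 0) N = rsum (fun m => g (p * m)%nat) (N / p).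
Proof.
  intros Hp. unfold dvd. induction N as [|N IH].
  - simpl. now rewrite Nat.Div0.div_0_l.
  - cbn [rsum]. rewrite IH.
    pose proof (Nat.div_mod_eq N p) as E1. pose proof (Nat.div_mod_eq (S N) p) as E2.
    pose proof (Nat.mod_upper_bound N p ltac:(lia)).
    pose proof (Nat.mod_upper_bound (S N) p ltac:(lia)).
    destruct (Nat.eqb_spec (S N mod p) 0) as [H1|H1].
    + assert (E : (S N / p = S (N / p))%nat) by nia.
      rewrite E. cbn [rsum]. f_equal. f_equal. nia.
    + assert (E : (S N / p = N / p)%nat) by nia. rewrite E. lra.
Qed.

Lemma rsum_single (p M : nat) (v : R) :
  (1 <= p <= M)%nat -> rsum (fun q => if q =? p then v else 0) M = v.
Proof.
  intros Hp. induction M as [|M IH]; [lia|]. cbn [rsum].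
  destruct (Nat.eq_dec p (S M)) as [->|E].
  - rewrite Nat.eqb_refl. rewrite (rsum_ext _ (fun _ => 0)), rsum_0; [lra|].
    intros n Hn. destruct (Nat.eqb_spec n (S M)); [lia|easy].
  - rewrite IH by lia. destruct (Nat.eqb_spec (S M) p); [lia|lra].
Qed.

Lemma rsum_single_le (p M : nat) (v : R) :
  0 <= v -> rsum (fun q => if q =? p then v else 0) M <= v.
Proof.
  intros Hv. destruct (le_lt_dec 1 p) as [H1|H1]; [destruct (le_lt_dec p M) as [H2|H2]|].
  - rewrite rsum_single; [lra|lia].
  - rewrite (rsum_ext _ (fun _ => 0)), rsum_0; [lra|].
    intros n Hn. destruct (Nat.eqb_spec n p); [lia|easy].
  - rewrite (rsum_ext _ (fun _ => 0)), rsum_0; [lra|].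
    intros n Hn. destruct (Nat.eqb_spec n p); [lia|easy].
Qed.

Lemma rsum_term_le (g : nat -> R) (n N : nat) :
  (forall k, (1 <= k)%nat -> 0 <= g k) -> (1 <= n <= N)%nat -> g n <= rsum g N.
Proof.
  intros Hg Hn. rewrite <- (rsum_single n N (g n)) by easy.
  apply rsum_le. intros k Hk. destruct (Nat.eqb_spec k n) as [->|]; [lra|now apply Hg].
Qed.

(* Summation by parts. *)
Lemma rsum_weight_le (a b w : nat -> R) (N : nat) :
  (forall n, (n <= N)%nat -> rsum a n <= rsum b n) ->
  (forall n, (1 <= n)%nat -> 0 <= w (S n) <= w n) ->
  rsum (fun n => a n * w n) N <= rsum (fun n => b n * w n) N.
Proof.
  intros Hab Hw.
  (* Abel summation. At k = 1 the factor [rsum b 0 - rsum a 0] vanishes, so the uncontrolled value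
     [w 0] does no harm. *)
  assert (H : forall n, rsum (fun k => (b k - a k) * w k) n
     = (rsum b n - rsum a n) * w n + rsum (fun k => (rsum b (k - 1) - rsum a (k - 1)) * (w (k - 1)%nat - w k)) n).
  { induction n as [|n IH]; [simpl; lra|].
    cbn [rsum]. rewrite IH. replace (S n - 1)%nat with n by lia.
    ring. }
  enough (0 <= rsum (fun k => (b k - a k) * w k) N) as H0.
  { rewrite (rsum_ext _ (fun k => b k * w k - a k * w k)) in H0 by (intros; ring).
    rewrite rsum_minus in H0. lra. }
  destruct N as [|N]; [simpl; lra|].
  rewrite H. apply Rplus_le_le_0_compat.
  - apply Rmult_le_pos.
    + specialize (Hab (S N) ltac:(lia)). lra.
    + destruct N as [|N]; [|apply Hw; lia]. pose proof (Hw 1%nat ltac:(lia)). lra.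
  - apply rsum_nonneg. intros [|[|k]] Hk; [lia|simpl; lra|].
    replace (S (S k) - 1)%nat with (S k) by lia.
    specialize (Hab (S k) ltac:(lia)). specialize (Hw (S k) ltac:(lia)).
    apply Rmult_le_pos; lra.
Qed.

(** * Elementary bounds: logarithms, harmonic sums, sums of n^(-1/2) and n^(-3/2) *)

Lemma ln_le_self (x : R) : 0 < x -> ln x <= x - 1.
Proof.
  intros Hx. pose proof (exp_ineq1_le (ln x)) as H. rewrite exp_ln in H by easy. lra.
Qed.

Lemma INR_ge1 (n : nat) : (1 <= n)%nat -> 1 <= INR n.
Proof. intros H. apply le_INR in H. simpl in H. lra. Qed.

Definition harm (N : nat) : R := rsum (fun n => / INR n) N.

Lemma harm_le (N : nat) : (1 <= N)%nat -> harm N <= 1 + ln (INR N).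
Proof.
  intros H. induction H as [|N H IH]; unfold harm in *.
  - simpl. rewrite ln_1. lra.
  - cbn [rsum]. pose proof (INR_ge1 N H). rewrite S_INR in *.
    enough (/ (INR N + 1) <= ln (INR N + 1) - ln (INR N)) by lra.
    pose proof (ln_le_self (INR N / (INR N + 1)) ltac:(apply Rdiv_lt_0_compat; lra)) as E.
    rewrite ln_div in E by lra.
    replace (INR N / (INR N + 1) - 1) with (- / (INR N + 1)) in E by (field; lra). lra.
Qed.

Lemma inv_INR_decr (n : nat) : (1 <= n)%nat -> 0 <= / INR (S n) <= / INR n.
Proof.
  intros H. pose proof (INR_ge1 n H). rewrite S_INR. split.
  - apply Rlt_le, Rinv_0_lt_compat; lra.
  - apply Rinv_le_contravar; lra.
Qed.

(** Partial summation against 1/n. It serves [lp] (turning Chebyshev into Mertens), [g] and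
    [g ^ 2]. *)
Lemma rsum_over_n_le (a : nat -> R) (B : R) (N : nat) :
  (forall n, (n <= N)%nat -> rsum a n <= B * INR n) ->
  rsum (fun n => a n * / INR n) N <= B * harm N.
Proof.
  intros H. unfold harm. rewrite <- rsum_scal.
  apply (rsum_weight_le a (fun _ => B)); [|apply inv_INR_decr].
  intros n Hn. rewrite rsum_const. now apply H.
Qed.

(** Apply ln y <= y - 1 to the fourth root y of x, where ln x = 4 ln y. Trading the squared
    logarithm for a square root leaves sums of powers that telescope. *)
Lemma ln_sq_le (x : R) : 1 <= x -> (ln x) ^ 2 <= 16 * sqrt x.
Proof.
  intros Hx. assert (1 <= sqrt x) by (rewrite <- sqrt_1; apply sqrt_le_1; lra).
  assert (H2 : 1 <= sqrt (sqrt x)) by (rewrite <- sqrt_1; apply sqrt_le_1; lra).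
  assert (E : ln x = 4 * ln (sqrt (sqrt x))).
  { rewrite <- (sqrt_sqrt x) at 1 by lra. rewrite ln_mult by lra.
    rewrite <- (sqrt_sqrt (sqrt x)) at 1 2 by lra. rewrite !ln_mult by lra. lra. }
  pose proof (ln_le_self (sqrt (sqrt x)) ltac:(lra)).
  assert (0 <= ln (sqrt (sqrt x))) by (rewrite <- ln_1; apply ln_le; lra).
  pose proof (sqrt_sqrt (sqrt x) ltac:(lra)) as E3.
  rewrite E. nra.
Qed.

Lemma rsum_inv_sqrt (N : nat) : rsum (fun n => / sqrt (INR n)) N <= 2 * sqrt (INR N).
Proof.
  induction N as [|N IH]; [simpl; rewrite sqrt_0; lra|]. cbn [rsum].
  rewrite S_INR. pose proof (pos_INR N).
  assert (Hs : 0 < sqrt (INR N + 1)) by (apply sqrt_lt_R0; lra).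
  pose proof (sqrt_sqrt (INR N + 1) ltac:(lra)). pose proof (sqrt_sqrt (INR N) ltac:(lra)).
  pose proof (sqrt_pos (INR N)).
  enough (/ sqrt (INR N + 1) <= 2 * (sqrt (INR N + 1) - sqrt (INR N))) by lra.
  apply Rmult_le_reg_l with (1 := Hs). rewrite Rinv_r by lra. nra.
Qed.

(** The term -2 / sqrt N makes the induction close, since 2 / sqrt n - 2 / sqrt (n + 1) exceeds (n +
    1)^(-3/2); the later bounds keep only the constant 3. *)
Lemma rsum_inv_three_halves (N : nat) :
  (1 <= N)%nat -> rsum (fun n => / (INR n * sqrt (INR n))) N <= 3 - 2 / sqrt (INR N).
Proof.
  intros H. induction H as [|N H IH].
  - simpl. rewrite sqrt_1. lra.
  - cbn [rsum]. eapply Rle_trans; [apply Rplus_le_compat_r, IH|].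
    pose proof (INR_ge1 N H). rewrite S_INR.
    assert (Hs : 0 < sqrt (INR N)) by (apply sqrt_lt_R0; lra).
    assert (Ht : 0 < sqrt (INR N + 1)) by (apply sqrt_lt_R0; lra).
    pose proof (sqrt_sqrt (INR N + 1) ltac:(lra)) as E1.
    pose proof (sqrt_sqrt (INR N) ltac:(lra)) as E2.
    set (s := sqrt (INR N)) in *. set (t := sqrt (INR N + 1)) in *.
    rewrite <- E1. assert (Hst : s < t) by nra.
    enough (0 <= 2 / s - 2 / t - / (t * t * t)) by lra.
    replace (2 / s - 2 / t - / (t * t * t))
      with ((2 * (t - s) * t * t - s) * / (s * t * t * t)) by (field; lra).
    apply Rmult_le_pos; [|apply Rlt_le, Rinv_0_lt_compat; repeat apply Rmult_lt_0_compat; easy].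
    assert ((t - s) * (t + s) = 1) by lra. nra.
Qed.

(** * Primes *)

Definition nprime (n : nat) : Prop := prime (Z.of_nat n).

Lemma nprime_ge2 (p : nat) : nprime p -> (2 <= p)%nat.
Proof. intros H. apply prime_ge_2 in H. lia. Qed.

Lemma Zdivide_nat (a b : nat) : Z.divide (Z.of_nat a) (Z.of_nat b) <-> Nat.divide a b.
Proof.
  split; intros [k Hk].
  - destruct (Nat.eq_dec b 0) as [->|Hb]; [apply Nat.divide_0_r|].
    exists (Z.to_nat k). nia.
  - exists (Z.of_nat k). nia.
Qed.

Lemma nprime_mult (p a b : nat) :
  nprime p -> Nat.divide p (a * b) -> Nat.divide p a \/ Nat.divide p b.
Proof.
  intros Hp H. apply Zdivide_nat in H. rewrite Nat2Z.inj_mul in H.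
  apply prime_mult in H; [|easy]. now rewrite <- !Zdivide_nat.
Qed.

Lemma nprime_divide_eq (p q : nat) : nprime p -> nprime q -> Nat.divide p q -> p = q.
Proof.
  intros Hp Hq H. apply Zdivide_nat in H.
  apply (prime_div_prime _ _ Hp Hq) in H. lia.
Qed.

Lemma nprime_factor (n : nat) : (2 <= n)%nat -> exists p, nprime p /\ Nat.divide p n.
Proof.
  induction n as [n IH] using lt_wf_ind. intros Hn.
  destruct (prime_dec (Z.of_nat n)) as [H|H].
  - exists n. split; [easy|apply Nat.divide_refl].
  - apply not_prime_divide in H; [|lia]. destruct H as [m [Hm Hd]].
    rewrite <- (Z2Nat.id m) in Hd by lia. apply Zdivide_nat in Hd.
    destruct (IH (Z.to_nat m)) as [p [Hp Hpm]]; [lia..|].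
    exists p. split; [easy|]. now apply Nat.divide_trans with (1 := Hpm).
Qed.

Lemma nprime_coprime (p m : nat) : nprime p -> ~ Nat.divide p m -> Nat.gcd p m = 1%nat.
Proof.
  intros Hp H. destruct (Nat.eq_dec (Nat.gcd p m) 1) as [E|E]; [easy|exfalso].
  pose proof (nprime_ge2 p Hp).
  assert (Nat.gcd p m <> 0)%nat by (intros E0; apply Nat.gcd_eq_0_l in E0; lia).
  destruct (nprime_factor (Nat.gcd p m)) as [q [Hq Hd]]; [lia|].
  assert (q = p).
  { apply nprime_divide_eq; try easy.
    apply Nat.divide_trans with (1 := Hd), Nat.gcd_divide_l. }
  subst q. apply H. apply Nat.divide_trans with (1 := Hd), Nat.gcd_divide_r.
Qed.

Definition lp (p : nat) : R := if prime_dec (Z.of_nat p) then ln (INR p) else 0.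

Lemma lp_prime (p : nat) : nprime p -> lp p = ln (INR p).
Proof. unfold lp, nprime. now destruct prime_dec. Qed.

Lemma lp_not_prime (p : nat) : ~ nprime p -> lp p = 0.
Proof. unfold lp, nprime. now destruct prime_dec. Qed.

Lemma lp_nonneg (p : nat) : 0 <= lp p.
Proof.
  unfold lp. destruct prime_dec as [H|H]; [|lra].
  apply nprime_ge2 in H. rewrite <- ln_1. apply ln_le; [lra|]. apply INR_ge1. lia.
Qed.

Lemma lp_le_ln (p N : nat) : (1 <= p <= N)%nat -> lp p <= ln (INR N).
Proof.
  intros H. assert (1 <= INR p) by (apply INR_ge1; lia).
  assert (INR p <= INR N) by (apply le_INR; lia).
  unfold lp. destruct prime_dec; [apply ln_le; lra|].
  rewrite <- ln_1. apply ln_le; lra.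
Qed.

Ltac dvdP p n :=
  let E := fresh "E" in
  let H := fresh "Hdvd" in
  destruct (dvd p n) eqn:E;
  [ assert (H : Nat.divide p n) by (apply dvd_spec; [lia|exact E])
  | assert (H : ~ Nat.divide p n) by (intros H; apply dvd_spec in H; [congruence|lia]) ];
  clear E.

(** Strip one prime factor q from n = mq: a prime dividing mq but not m must be q, and it costs ln q
    = ln n - ln m. *)
Lemma rsum_lp_divisors_le (n M : nat) :
  (1 <= n)%nat -> rsum (fun p => if dvd p n then lp p else 0) M <= ln (INR n).
Proof.
  induction n as [n IH] using lt_wf_ind. intros Hn.
  destruct (Nat.eq_dec n 1) as [->|Hn1].
  - simpl INR. rewrite ln_1. apply Rle_trans with (rsum (fun _ => 0) M); [|rewrite rsum_0; lra].
    apply rsum_le. intros p Hp.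
    dvdP p 1%nat; [|lra]. apply Nat.divide_1_r in Hdvd. subst p.
    rewrite lp_not_prime; [lra|]. intros H. apply nprime_ge2 in H. lia.
  - destruct (nprime_factor n) as [q [Hq [m Hm]]]; [lia|].
    pose proof (nprime_ge2 q Hq). assert (1 <= m < n)%nat by nia.
    specialize (IH m ltac:(lia) ltac:(lia)).
    assert (1 <= INR m) by (apply INR_ge1; lia).
    assert (1 <= INR q) by (apply INR_ge1; lia).
    rewrite Hm, mult_INR, ln_mult by lra.
    apply Rle_trans with (rsum (fun p => (if dvd p m then lp p else 0)
       + (if p =? q then lp q else 0)) M).
    + apply rsum_le. intros p Hp. pose proof (lp_nonneg p). pose proof (lp_nonneg q).
      dvdP p (m * q)%nat; dvdP p m;
        destruct (Nat.eqb_spec p q) as [->|Hpq]; try lra.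
      rewrite lp_not_prime; [lra|]. intros Hpp.
      destruct (nprime_mult p m q Hpp Hdvd) as [H5|H5]; [easy|].
      now apply nprime_divide_eq in H5.
    + rewrite rsum_plus.
      pose proof (rsum_single_le q M (lp q) (lp_nonneg q)).
      rewrite lp_prime in * by easy. lra.
Qed.

(* d^2 | n absorbs the primes whose square divides n, so that only the primes
   p || n remain on the right. *)
Lemma ln_le_exact_divisors (n : nat) :
  (1 <= n)%nat -> exists d, (1 <= d)%nat /\ Nat.divide (d * d) n /\
  forall M, (n <= M)%nat ->
    ln (INR n) <= 3 * ln (INR d)
      + rsum (fun p => if dvd p n && negb (dvd p (n / p)) then lp p else 0) M.
Proof.
  induction n as [n IH] using lt_wf_ind. intros Hn.
  destruct (Nat.eq_dec n 1) as [->|Hn1].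
  { exists 1%nat. split; [lia|]. split; [apply Nat.divide_refl|]. intros M _.
    simpl INR. rewrite ln_1.
    enough (0 <= rsum (fun p => if dvd p 1 && negb (dvd p (1 / p)) then lp p else 0) M) by lra.
    apply rsum_nonneg. intros p Hp. destruct (_ && _); [apply lp_nonneg|lra]. }
  destruct (nprime_factor n) as [q [Hq [m Hm]]]; [lia|].
  pose proof (nprime_ge2 q Hq). assert (1 <= m < n)%nat by nia.
  assert (1 <= INR q) by (apply INR_ge1; lia).
  dvdP q m.
  (* Here n = k q^2 and d gains a factor q. Of the resulting 3 ln q, two pay for q^2, and the third
     pays for the loss of q as an exact divisor in case it divides k exactly. This is the origin of
     the constant 3. *)
  - destruct Hdvd as [k Hk]. assert (1 <= k < m)%nat by nia.
    destruct (IH k ltac:(lia) ltac:(lia)) as [d [Hd [[j Hj] Hsum]]].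
    exists (d * q)%nat. split; [nia|]. split; [exists j; nia|]. intros M HM.
    specialize (Hsum M ltac:(lia)).
    assert (1 <= INR k) by (apply INR_ge1; lia).
    assert (1 <= INR d) by (apply INR_ge1; lia).
    assert (Hn' : n = (k * q * q)%nat) by nia.
    rewrite Hn' at 1. rewrite !mult_INR, !ln_mult; try nra.
    enough (rsum (fun p => if dvd p k && negb (dvd p (k / p)) then lp p else 0) M
      <= rsum (fun p => (if dvd p n && negb (dvd p (n / p)) then lp p else 0)
          + (if p =? q then lp q else 0)) M) as H6.
    { rewrite rsum_plus in H6.
      pose proof (rsum_single_le q M (lp q) (lp_nonneg q)).
      rewrite lp_prime in * by easy. lra. }
    apply rsum_le. intros p Hp.
    destruct (Nat.eqb_spec p q) as [->|Hpq].
    { pose proof (lp_nonneg q). destruct (_ && _), (_ && _); lra. }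
    destruct (prime_dec (Z.of_nat p)) as [Hpp|Hpp].
    2:{ rewrite lp_not_prime by easy. destruct (_ && _), (_ && _); lra. }
    dvdP p k; [|simpl; pose proof (lp_nonneg p); destruct (_ && _); lra].
    destruct Hdvd as [i Hi].
    replace (k / p)%nat with i by (rewrite Hi, Nat.div_mul; lia).
    assert (En : (n / p = i * (q * q))%nat).
    { replace n with (i * (q * q) * p)%nat by nia. apply Nat.div_mul. lia. }
    rewrite En. assert (Edvd : dvd p n = true) by (apply dvd_spec; [lia|exists (i * (q * q))%nat; nia]).
    rewrite Edvd.
    dvdP p i; simpl; [dvdP p (i * (q * q))%nat; simpl; pose proof (lp_nonneg p); lra|].
    dvdP p (i * (q * q))%nat; simpl; [|lra]. exfalso.
    apply nprime_mult in Hdvd0; [|easy]. destruct Hdvd0 as [H7|H7]; [easy|].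
    apply nprime_mult in H7; [|easy].
    destruct H7 as [H7|H7]; apply nprime_divide_eq in H7; easy.
  (* Now q divides n exactly, so it enters the sum over exact divisors itself and d is kept. *)
  - destruct (IH m ltac:(lia) ltac:(lia)) as [d [Hd [[j Hj] Hsum]]].
    exists d. split; [lia|]. split; [exists (j * q)%nat; nia|]. intros M HM.
    specialize (Hsum M ltac:(lia)).
    assert (1 <= INR m) by (apply INR_ge1; lia).
    rewrite Hm at 1. rewrite mult_INR, ln_mult by lra.
    enough (rsum (fun p => (if dvd p m && negb (dvd p (m / p)) then lp p else 0)
           + (if p =? q then lp q else 0)) M
      <= rsum (fun p => if dvd p n && negb (dvd p (n / p)) then lp p else 0) M) as H6.
    { rewrite rsum_plus, rsum_single in H6 by nia.
      rewrite (lp_prime q) in * by easy. lra. }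
    apply rsum_le. intros p Hp.
    destruct (Nat.eqb_spec p q) as [->|Hpq].
    { replace (dvd q n) with true by (symmetry; apply dvd_spec; [lia|exists m; nia]).
      replace (n / q)%nat with m by (rewrite Hm, Nat.div_mul; lia).
      dvdP q m; [easy|]. simpl. lra. }
    destruct (prime_dec (Z.of_nat p)) as [Hpp|Hpp].
    2:{ rewrite lp_not_prime by easy. destruct (_ && _), (_ && _); lra. }
    dvdP p m; [|simpl; pose proof (lp_nonneg p); destruct (_ && _); lra].
    destruct Hdvd0 as [i Hi].
    replace (m / p)%nat with i by (rewrite Hi, Nat.div_mul; lia).
    assert (En : (n / p = i * q)%nat).
    { replace n with (i * q * p)%nat by nia. apply Nat.div_mul. lia. }
    rewrite En. assert (Edvd : dvd p n = true) by (apply dvd_spec; [lia|exists (i * q)%nat; nia]).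
    rewrite Edvd.
    dvdP p i; simpl; [dvdP p (i * q)%nat; simpl; pose proof (lp_nonneg p); lra|].
    dvdP p (i * q)%nat; simpl; [|lra]. exfalso.
    apply nprime_mult in Hdvd1; [|easy]. destruct Hdvd1 as [H7|H7]; [easy|].
    apply nprime_divide_eq in H7; easy.
Qed.

(** * Chebyshev's upper bound through central binomial coefficients *)

Fixpoint binom (n k : nat) : nat :=
  match n, k with
  | _, O => 1
  | O, S _ => 0
  | S n', S k' => binom n' k' + binom n' k
  end.

Lemma binom_le (n k : nat) : (binom n k <= 2 ^ n)%nat.
Proof.
  revert k. induction n as [|n IH]; intros [|k]; cbn [binom]; try (simpl; lia).
  - pose proof (Nat.pow_nonzero 2 (S n)). lia.
  - pose proof (IH k). pose proof (IH (S k)). rewrite Nat.pow_succ_r'. lia.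
Qed.

Lemma binom_gt (n k : nat) : (n < k)%nat -> binom n k = 0%nat.
Proof.
  revert k. induction n as [|n IH]; intros [|k] H; try lia; cbn [binom]; [easy|].
  rewrite !IH; lia.
Qed.

Lemma binom_fact (n k : nat) : (k <= n)%nat ->
  (binom n k * (fact k * fact (n - k)) = fact n)%nat.
Proof.
  revert k. induction n as [|n IH]; intros [|k] H; try lia; cbn [binom].
  - easy.
  - rewrite Nat.sub_0_r. change (fact 0) with 1%nat. lia.
  - destruct (Nat.eq_dec k n) as [->|Hk].
    + rewrite (binom_gt n (S n)) by lia. pose proof (IH n ltac:(lia)) as E.
      rewrite Nat.sub_diag in *. change (fact 0) with 1%nat in *.
      rewrite !fact_simpl. nia.
    + pose proof (IH k ltac:(lia)) as E1. pose proof (IH (S k) ltac:(lia)) as E2.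
      replace (S n - S k)%nat with (S (n - S k)) by lia.
      replace (n - k)%nat with (S (n - S k)) in E1 by lia.
      rewrite !fact_simpl in *.
      assert (En : n = (k + S (n - S k))%nat) by lia.
      set (r := (n - S k)%nat) in *.
      replace (S n) with (S k + S r)%nat by lia. nia.
Qed.

Lemma nprime_divide_fact (p n : nat) : nprime p -> Nat.divide p (fact n) <-> (p <= n)%nat.
Proof.
  intros Hp. pose proof (nprime_ge2 p Hp). split.
  - induction n as [|n IH]; intros H1.
    + apply Nat.divide_1_r in H1. lia.
    + rewrite fact_simpl in H1. apply nprime_mult in H1; [|easy]. destruct H1 as [H1|H1].
      * apply Nat.divide_pos_le in H1; lia.
      * apply IH in H1. lia.
  - induction n as [|n IH]; intros H1; [lia|]. rewrite fact_simpl.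
    destruct (Nat.eq_dec p (S n)) as [->|E].
    + apply Nat.divide_factor_l.
    + apply Nat.divide_mul_r, IH. lia.
Qed.

(** Such a p divides (2k)! but not k!, hence it divides the quotient of (2k)! by (k!)^2. *)
Lemma nprime_divide_central_binom (p k : nat) :
  nprime p -> (k < p <= 2 * k)%nat -> Nat.divide p (binom (2 * k) k).
Proof.
  intros Hp H. pose proof (binom_fact (2 * k) k ltac:(lia)) as E.
  replace (2 * k - k)%nat with k in E by lia.
  assert (H1 : Nat.divide p (fact (2 * k))) by (apply nprime_divide_fact; [easy|lia]).
  rewrite <- E in H1. apply nprime_mult in H1; [|easy]. destruct H1 as [H1|H1]; [easy|].
  apply nprime_mult in H1; [|easy].
  destruct H1 as [H1|H1]; apply nprime_divide_fact in H1; (easy || lia).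
Qed.

Definition theta (n : nat) : R := rsum lp n.

(** The primes in (k, 2k] all divide the central binomial coefficient, which is at most 4^k;
    [rsum_lp_divisors_le] bounds the sum of their logarithms by 2k ln 2 <= 2k. *)
Lemma theta_double (k : nat) : (1 <= k)%nat -> theta (2 * k) <= theta k + 2 * INR k.
Proof.
  intros Hk. unfold theta.
  assert (Hb : (1 <= binom (2 * k) k)%nat).
  { pose proof (binom_fact (2 * k) k ltac:(lia)). pose proof (lt_O_fact (2 * k)). nia. }
  assert (H1 : ln (INR (binom (2 * k) k)) <= 2 * INR k).
  { apply Rle_trans with (ln (INR (2 ^ (2 * k)))).
    - apply ln_le; [pose proof (INR_ge1 _ Hb); lra|]. apply le_INR, binom_le.
    - rewrite pow_INR. change (INR 2) with 2. rewrite ln_pow, mult_INR by lra.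
      change (INR 2) with 2. pose proof (ln_le_self 2 ltac:(lra)).
      pose proof (pos_INR k). nra. }
  pose proof (rsum_lp_divisors_le _ (2 * k) Hb) as H2.
  rewrite <- (rsum_truncate lp k (2 * k)) by lia.
  apply Rle_trans with (rsum (fun n => (if n <=? k then lp n else 0)
    + (if dvd n (binom (2 * k) k) then lp n else 0)) (2 * k)); [|rewrite rsum_plus; lra].
  apply rsum_le. intros p Hp. pose proof (lp_nonneg p).
  destruct (Nat.leb_spec p k); [destruct (dvd _ _); lra|].
  destruct (prime_dec (Z.of_nat p)) as [Hpp|Hpp].
  - dvdP p (binom (2 * k) k); [lra|]. exfalso. apply Hdvd.
    apply nprime_divide_central_binom; [easy|lia].
  - rewrite lp_not_prime by easy. destruct (dvd _ _); lra.
Qed.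

(** Induction by halving. An odd n = 2k + 1 is rounded up to 2(k + 1), and the constant 4 leaves
    room for this: 6k + 6 <= 8k + 4 once k >= 1. *)
Lemma theta_le (n : nat) : theta n <= 4 * INR n.
Proof.
  induction n as [n IH] using lt_wf_ind.
  destruct (le_lt_dec n 1) as [H|H].
  - unfold theta. destruct n as [|[|n]]; [simpl; lra| |lia]. cbn [rsum].
    rewrite lp_not_prime; [simpl; lra|]. intros H1. apply nprime_ge2 in H1. lia.
  - destruct (Nat.Even_or_Odd n) as [[k Hk]|[k Hk]].
    + pose proof (theta_double k ltac:(lia)). pose proof (IH k ltac:(lia)).
      rewrite Hk, mult_INR. change (INR 2) with 2. pose proof (pos_INR k). lra.
    + pose proof (theta_double (S k) ltac:(lia)) as H1. pose proof (IH (S k) ltac:(lia)) as H2.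
      assert (H3 : theta n <= theta (2 * S k)).
      { apply rsum_le_extend; [lia|]. intros; apply lp_nonneg. }
      assert (H4 : 1 <= INR k) by (apply INR_ge1; lia).
      assert (H5 : INR n = 2 * INR k + 1).
      { rewrite Hk, plus_INR, mult_INR. simpl. lra. }
      pose proof (S_INR k). lra.
Qed.

Lemma rsum_lp_over_p_le (n : nat) : rsum (fun p => lp p * / INR p) n <= 4 * harm n.
Proof. apply rsum_over_n_le. intros m _. apply theta_le. Qed.

(** * The sawtooth function and Diophantine spacing *)

(** A crude Jordan inequality: up to PI/3 the derivative is at least 1/2, and beyond it sin a >=
    sqrt 3 / 2. Since PI > 3, the factor 1/3 disappears for sin (PI y). *)
Lemma sin_ge_third (a : R) : 0 <= a <= PI / 2 -> a / 3 <= sin a.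
Proof.
  intros [H0 H1]. pose proof PI_RGT_0. pose proof PI_4.
  destruct (Rle_lt_dec a (PI / 3)) as [H3|H3].
  - destruct (MVT_gen sin 0 a cos) as [c [Hc E]].
    + intros x _. apply is_derive_Reals, derivable_pt_lim_sin.
    + intros x _. apply continuity_sin.
    + rewrite Rmin_left, Rmax_right in Hc by lra.
      rewrite sin_0 in E.
      assert (1 / 2 <= cos c) by (rewrite <- cos_PI3; apply cos_decr_1; lra).
      nra.
  - assert (H4 : sin (PI / 3) <= sin a) by (apply sin_incr_1; lra).
    rewrite sin_PI3 in H4.
    assert (1.7 <= sqrt 3).
    { rewrite <- (sqrt_square 1.7) by lra. apply sqrt_le_1; lra. }
    lra.
Qed.

Lemma sin_PI_ge (y d : R) : 0 <= d -> d <= y <= 1 - d -> d <= sin (PI * y).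
Proof.
  intros Hd Hy. pose proof PI_RGT_0. pose proof PI2_3_2.
  destruct (Rle_lt_dec y (1 / 2)) as [H1|H1].
  - pose proof (sin_ge_third (PI * y) ltac:(nra)). nra.
  - replace (PI * y) with (PI - PI * (1 - y)) by ring.
    rewrite sin_PI_x. pose proof (sin_ge_third (PI * (1 - y)) ltac:(nra)). nra.
Qed.

Lemma sin_cos_period_Z (x : R) (j : Z) :
  sin (x + 2 * PI * IZR j) = sin x /\ cos (x + 2 * PI * IZR j) = cos x.
Proof.
  assert (H : forall y n, sin (y + 2 * PI * INR n) = sin y /\ cos (y + 2 * PI * INR n) = cos y).
  { intros y n. replace (y + 2 * PI * INR n) with (y + 2 * INR n * PI) by ring.
    split; [apply sin_period|apply cos_period]. }
  destruct (Z_le_gt_dec 0 j) as [Hj|Hj].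
  - rewrite <- (Z2Nat.id j Hj), <- INR_IZR_INZ. apply H.
  - destruct (H (x + 2 * PI * IZR j) (Z.to_nat (- j))) as [H1 H2].
    rewrite INR_IZR_INZ, Z2Nat.id, opp_IZR in H1, H2 by lia.
    replace (x + 2 * PI * IZR j + 2 * PI * - IZR j) with x in * by ring. easy.
Qed.

Definition fpart (x : R) : R := x - IZR (Int_part x).

Lemma fpart_bounds (x : R) : 0 <= fpart x < 1.
Proof. unfold fpart. pose proof (base_Int_part x). lra. Qed.

(** The condition ||x|| >= d. With all integers quantified, two failures can be subtracted without
    identifying nearest integers. *)
Definition away (d x : R) : Prop := forall j : Z, d <= Rabs (x - IZR j).

Lemma away_fpart (d x : R) : away d x -> d <= fpart x <= 1 - d.
Proof.
  intros H. pose proof (fpart_bounds x) as Hb. unfold fpart in *.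
  pose proof (H (Int_part x)) as H1. pose proof (H (Int_part x + 1)%Z) as H2.
  rewrite plus_IZR in H2. rewrite Rabs_pos_eq in H1 by lra.
  rewrite Rabs_left1 in H2 by lra. lra.
Qed.

(** A unit shift changes the sign of sin (PI x), so only its square has period 1; the double angle
    formula reduces this to the period of the cosine. *)
Lemma sin_PI_fpart_sqr (x : R) : sin (PI * x) ^ 2 = sin (PI * fpart x) ^ 2.
Proof.
  assert (H : forall y, sin (PI * y) ^ 2 = (1 - cos (2 * PI * y)) / 2).
  { intros y. replace (2 * PI * y) with (2 * (PI * y)) by ring. rewrite cos_2a_sin. field. }
  rewrite !H. unfold fpart.
  replace (2 * PI * (x - IZR (Int_part x)))
    with (2 * PI * x + 2 * PI * IZR (- Int_part x)) by (rewrite opp_IZR; ring).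
  now rewrite (proj2 (sin_cos_period_Z _ _)).
Qed.

Lemma away_sin (d x : R) : 0 <= d -> away d x -> d <= Rabs (sin (PI * x)).
Proof.
  intros Hd H. apply away_fpart in H.
  pose proof (sin_PI_ge _ d Hd H) as H1.
  rewrite <- (Rabs_pos_eq d) by easy. apply Rsqr_le_abs_0.
  rewrite !Rsqr_pow2, (sin_PI_fpart_sqr x). nra.
Qed.

(** Each 2 sin(phi/2) cos(m phi) is a difference of consecutive sines, and summation by parts with
    the weight m leaves one boundary term and b sines. The weight m is the one that Cauchy-Schwarz
    introduces later. *)
Lemma rsum_m_cos (phi : R) (b : nat) :
  2 * sin (phi / 2) * rsum (fun m => INR m * cos (INR m * phi)) b
  = INR b * sin ((INR b + / 2) * phi) - rsum (fun m => sin ((INR m - / 2) * phi)) b.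
Proof.
  induction b as [|b IH]; [simpl; ring|].
  cbn [rsum]. rewrite Rmult_plus_distr_l, IH, !S_INR.
  assert (E : 2 * sin (phi / 2) * cos ((INR b + 1) * phi)
     = sin ((INR b + 1 + / 2) * phi) - sin ((INR b + / 2) * phi)).
  { replace ((INR b + 1 + / 2) * phi) with ((INR b + 1) * phi + phi / 2) by field.
    replace ((INR b + / 2) * phi) with ((INR b + 1) * phi - phi / 2) by field.
    rewrite sin_plus, sin_minus. ring. }
  replace (2 * sin (phi / 2) * ((INR b + 1) * cos ((INR b + 1) * phi)))
    with ((INR b + 1) * (2 * sin (phi / 2) * cos ((INR b + 1) * phi))) by ring.
  rewrite E. replace (INR b + 1 - / 2) with (INR b + / 2) by field. ring.
Qed.

Lemma rsum_m_cos_le (phi : R) (b : nat) :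
  Rabs (sin (phi / 2)) * Rabs (rsum (fun m => INR m * cos (INR m * phi)) b) <= INR b.
Proof.
  rewrite <- Rabs_mult. apply Rmult_le_reg_l with 2; [lra|].
  rewrite <- (Rabs_pos_eq 2) at 1 by lra.
  rewrite <- Rabs_mult, <- Rmult_assoc, rsum_m_cos.
  eapply Rle_trans; [apply Rabs_triang|]. rewrite Rabs_Ropp.
  assert (rsum (fun m => Rabs (sin ((INR m - / 2) * phi))) b <= INR b).
  { rewrite <- (Rmult_1_l (INR b)), <- rsum_const. apply rsum_le. intros.
    apply Rabs_le, SIN_bound. }
  pose proof (rsum_abs (fun m => sin ((INR m - / 2) * phi)) b).
  rewrite Rabs_mult, (Rabs_pos_eq (INR b)) by apply pos_INR.
  assert (Rabs (sin ((INR b + / 2) * phi)) <= 1) by apply Rabs_le, SIN_bound.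
  pose proof (pos_INR b). nra.
Qed.

Lemma rsum_m_cos_trivial (phi : R) (b : nat) :
  Rabs (rsum (fun m => INR m * cos (INR m * phi)) b) <= INR b ^ 2.
Proof.
  eapply Rle_trans; [apply rsum_abs|].
  replace (INR b ^ 2) with (INR b * INR b) by ring. rewrite <- rsum_const.
  apply rsum_le. intros m Hm. rewrite Rabs_mult, (Rabs_pos_eq (INR m)) by apply pos_INR.
  assert (Rabs (cos (INR m * phi)) <= 1) by apply Rabs_le, COS_bound.
  assert (INR m <= INR b) by (apply le_INR; lia). pose proof (pos_INR m).
  pose proof (Rabs_pos (cos (INR m * phi))). nra.
Qed.

(** * Fourier approximation of the sawtooth *)

Definition saw (x : R) : R := 1 / 2 - fpart x.

Definition sawpoly (K : nat) (x : R) : R :=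
  rsum (fun k => / (PI * INR k) * sin (2 * PI * INR k * x)) K.

Lemma rsum_cos (x : R) (K : nat) :
  2 * sin (PI * x) * rsum (fun k => cos (2 * PI * INR k * x)) K
  = sin ((2 * INR K + 1) * PI * x) - sin (PI * x).
Proof.
  induction K as [|K IH].
  - simpl. replace ((2 * 0 + 1) * PI * x) with (PI * x) by ring. ring.
  - cbn [rsum]. rewrite Rmult_plus_distr_l, IH, S_INR.
    replace ((2 * (INR K + 1) + 1) * PI * x) with (2 * PI * (INR K + 1) * x + PI * x) by ring.
    replace ((2 * INR K + 1) * PI * x) with (2 * PI * (INR K + 1) * x - PI * x) by ring.
    rewrite sin_plus, sin_minus. ring.
Qed.

Lemma is_derive_sawpoly (K : nat) (x : R) :
  is_derive (sawpoly K) x (rsum (fun k => 2 * cos (2 * PI * INR k * x)) K).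
Proof.
  induction K as [|K IH].
  - apply (is_derive_const (0 : R)).
  - unfold sawpoly in *. cbn [rsum].
    apply (is_derive_plus (fun x => rsum (fun k => / (PI * INR k) * sin (2 * PI * INR k * x)) K)).
    + exact IH.
    + pose proof PI_RGT_0. pose proof (INR_ge1 (S K) ltac:(lia)).
      set (r := INR (S K)) in *. auto_derive; [easy|]. field. split; lra.
Qed.

Lemma sin_PI_INR (n : nat) : sin (PI * INR n) = 0.
Proof. apply sin_eq_0_1. exists (Z.of_nat n). rewrite INR_IZR_INZ. ring. Qed.

Lemma sawpoly_half (K : nat) : sawpoly K (1 / 2) = 0.
Proof.
  unfold sawpoly. rewrite (rsum_ext _ (fun _ => 0)); [apply rsum_0|]. intros k _.
  replace (2 * PI * INR k * (1 / 2)) with (PI * INR k) by field.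
  rewrite sin_PI_INR. ring.
Qed.

(* Adding cos((2K+1) pi x) / ((2K+1) pi sin(pi x)) to the error integrates the
   oscillating Dirichlet kernel by parts once, so that the derivative of the
   sum is already O(1/K). *)
Lemma sawpoly_approx_01 (K : nat) (x : R) :
  (1 <= K)%nat -> 0 < x < 1 ->
  Rabs (1 / 2 - x - sawpoly K x) <= / (INR K * sin (PI * x) ^ 2).
Proof.
  intros HK Hx. pose proof PI_RGT_0 as Hpi. pose proof PI2_3_2.
  assert (HK1 : 1 <= INR K) by now apply INR_ge1.
  set (M := 2 * INR K + 1).
  set (F := fun y => sawpoly K y - (1 / 2 - y) + cos (M * PI * y) / (M * PI * sin (PI * y))).
  set (dF := fun y => - (cos (M * PI * y) * cos (PI * y)) / (M * sin (PI * y) ^ 2)).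
  assert (Hs : forall y, 0 < y < 1 -> 0 < sin (PI * y)) by (intros; apply sin_gt_0; nra).
  assert (HD : forall y, 0 < y < 1 -> is_derive F y (dF y)).
  { intros y Hy. specialize (Hs y Hy).
    replace (dF y) with (rsum (fun k => 2 * cos (2 * PI * INR k * y)) K
      + (1 - (M * PI * sin (M * PI * y) * sin (PI * y) + cos (M * PI * y) * PI * cos (PI * y))
              / (M * PI * sin (PI * y) ^ 2))).
    - unfold F.
      apply (is_derive_ext (fun y => sawpoly K y + ((y - 1 / 2)
         + cos (M * PI * y) / (M * PI * sin (PI * y))))); [intros; simpl; lra|].
      apply (is_derive_plus (sawpoly K)); [apply is_derive_sawpoly|].
      assert (M <> 0) by (unfold M; lra).
      auto_derive.
      + assert (0 < PI * sin (PI * y)) by nra. nra.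
      + field. repeat split; lra.
    - rewrite rsum_scal. pose proof (rsum_cos y K) as E. fold M in E.
      unfold dF.
      assert (E2 : 2 * rsum (fun k => cos (2 * PI * INR k * y)) K
         = (sin (M * PI * y) - sin (PI * y)) / sin (PI * y)) by (rewrite <- E; field; lra).
      rewrite E2. assert (M <> 0) by (unfold M; lra). field. repeat split; lra. }
  assert (Hin : forall y, Rmin x (1 / 2) <= y <= Rmax x (1 / 2) -> 0 < y < 1).
  { intros y. unfold Rmin, Rmax. destruct Rle_dec; lra. }
  destruct (MVT_gen F x (1 / 2) dF) as [c [Hc E]].
  { intros y Hy. apply HD, Hin. lra. }
  { intros y Hy. apply derivable_continuous_pt. exists (dF y).
    apply is_derive_Reals. now apply HD, Hin. }
  (* The midpoint anchors the mean value theorem: the sawtooth and the polynomial vanish there, and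
     so does cos (M PI / 2) because M is odd. *)
  assert (F0 : F (1 / 2) = 0).
  { unfold F. rewrite sawpoly_half.
    replace (M * PI * (1 / 2)) with (PI * INR K + PI / 2) by (unfold M; field).
    rewrite cos_plus, sin_PI_INR, cos_PI2. unfold Rdiv. ring. }
  pose proof (Hs x Hx) as Hsx. set (s := sin (PI * x)) in *.
  (* The sine grows from x towards the midpoint on either side, so on the whole segment it is at
     least its value at x. *)
  assert (Hsc : s <= sin (PI * c)).
  { unfold s. destruct (Rle_lt_dec x (1 / 2)) as [H1|H1].
    - rewrite Rmin_left, Rmax_right in Hc by lra. apply sin_incr_1; nra.
    - rewrite Rmin_right, Rmax_left in Hc by lra. apply sin_decr_1; nra. }
  assert (HM : 2 * INR K <= M) by (unfold M; lra).
  assert (Hs1 : s <= 1) by apply SIN_bound.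
  assert (Hms : 0 < M * s ^ 2) by (apply Rmult_lt_0_compat; [lra|nra]).
  assert (Hdc : Rabs (dF c) <= / (M * s ^ 2)).
  { unfold dF, Rdiv. rewrite Rabs_mult, Rabs_Ropp, Rabs_mult.
    assert (Rabs (cos (M * PI * c)) <= 1) by apply Rabs_le, COS_bound.
    assert (Rabs (cos (PI * c)) <= 1) by apply Rabs_le, COS_bound.
    pose proof (Rabs_pos (cos (M * PI * c))). pose proof (Rabs_pos (cos (PI * c))).
    assert (H8 : / (M * sin (PI * c) ^ 2) <= / (M * s ^ 2)).
    { apply Rinv_le_contravar; [easy|]. apply Rmult_le_compat_l; [lra|]. nra. }
    rewrite (Rabs_pos_eq (/ _)).
    2:{ apply Rlt_le, Rinv_0_lt_compat, Rmult_lt_0_compat; [lra|]. nra. }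
    assert (0 < / (M * sin (PI * c) ^ 2)).
    { apply Rinv_0_lt_compat, Rmult_lt_0_compat; [lra|]. nra. }
    assert (Rabs (cos (M * PI * c)) * Rabs (cos (PI * c)) <= 1) by nra.
    apply Rle_trans with (1 * / (M * sin (PI * c) ^ 2)); [|lra].
    apply Rmult_le_compat_r; lra. }
  assert (HF : Rabs (F x) <= / (M * s ^ 2) / 2).
  { rewrite F0 in E. replace (F x) with (- (dF c * (1 / 2 - x))) by lra.
    rewrite Rabs_Ropp, Rabs_mult.
    assert (Rabs (1 / 2 - x) <= 1 / 2) by (apply Rabs_le; lra).
    pose proof (Rabs_pos (1 / 2 - x)). pose proof (Rabs_pos (dF c)). nra. }
  assert (HC : Rabs (cos (M * PI * x) / (M * PI * s)) <= / (M * s ^ 2)).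
  { unfold Rdiv. rewrite Rabs_mult.
    assert (Rabs (cos (M * PI * x)) <= 1) by apply Rabs_le, COS_bound.
    assert (0 < PI * s) by (apply Rmult_lt_0_compat; lra).
    assert (0 < M * PI * s) by (rewrite Rmult_assoc; apply Rmult_lt_0_compat; lra).
    rewrite (Rabs_pos_eq (/ _)) by now apply Rlt_le, Rinv_0_lt_compat.
    assert (/ (M * PI * s) <= / (M * s ^ 2)).
    { apply Rinv_le_contravar; [easy|].
      replace (M * PI * s) with (M * (PI * s)) by ring.
      apply Rmult_le_compat_l; [lra|]. nra. }
    assert (0 < / (M * PI * s)) by now apply Rinv_0_lt_compat.
    pose proof (Rabs_pos (cos (M * PI * x))). nra. }
  replace (1 / 2 - x - sawpoly K x) with (cos (M * PI * x) / (M * PI * s) - F x)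
    by (unfold F; fold s; ring).
  assert (HK2 : / (M * s ^ 2) * 2 <= / (INR K * s ^ 2)).
  { assert (0 < INR K * s ^ 2) by (apply Rmult_lt_0_compat; [lra|nra]).
    replace (/ (INR K * s ^ 2)) with (/ (2 * (INR K * s ^ 2)) * 2) by (field; split; nra).
    apply Rmult_le_compat_r; [lra|]. apply Rinv_le_contravar; nra. }
  unfold Rminus. eapply Rle_trans; [apply Rabs_triang|]. rewrite Rabs_Ropp.
  assert (0 < / (M * s ^ 2)) by now apply Rinv_0_lt_compat. lra.
Qed.

Lemma sawpoly_fpart (K : nat) (x : R) : sawpoly K x = sawpoly K (fpart x).
Proof.
  unfold sawpoly. apply rsum_ext. intros k _. f_equal. unfold fpart.
  replace (2 * PI * INR k * (x - IZR (Int_part x)))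
    with (2 * PI * INR k * x + 2 * PI * IZR (- (Z.of_nat k * Int_part x))).
  - now rewrite (proj1 (sin_cos_period_Z _ _)).
  - rewrite opp_IZR, mult_IZR, <- INR_IZR_INZ. ring.
Qed.

Lemma sawpoly_approx (K : nat) (x d : R) :
  (1 <= K)%nat -> 0 < d -> away d x ->
  Rabs (saw x - sawpoly K x) <= / (INR K * d ^ 2).
Proof.
  intros HK Hd H. apply away_fpart in H. rewrite sawpoly_fpart. unfold saw.
  eapply Rle_trans; [apply sawpoly_approx_01; [easy|lra]|].
  pose proof (INR_ge1 K HK). pose proof (sin_PI_ge _ d ltac:(lra) H).
  apply Rinv_le_contravar; [apply Rmult_lt_0_compat; nra|].
  apply Rmult_le_compat_l; [lra|nra].
Qed.

(** Meant for the few points close to an integer, where [sawpoly] need not approximate [saw]. For K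
    a power of L this loses only O(L). *)
Lemma sawpoly_le (K : nat) (x : R) : Rabs (sawpoly K x) <= harm K.
Proof.
  unfold sawpoly, harm. eapply Rle_trans; [apply rsum_abs|]. apply rsum_le. intros k Hk.
  pose proof PI2_3_2. pose proof (INR_ge1 k ltac:(lia)).
  rewrite Rabs_mult.
  assert (Rabs (sin (2 * PI * INR k * x)) <= 1) by apply Rabs_le, SIN_bound.
  assert (/ (PI * INR k) <= / INR k) by (apply Rinv_le_contravar; nra).
  assert (0 < / (PI * INR k)) by (apply Rinv_0_lt_compat; nra).
  rewrite (Rabs_pos_eq (/ _)) by lra.
  pose proof (Rabs_pos (sin (2 * PI * INR k * x))). nra.
Qed.

Lemma saw_le (x : R) : Rabs (saw x) <= 1 / 2.
Proof. unfold saw. pose proof (fpart_bounds x). apply Rabs_le. lra. Qed.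

(** * Counting the points whose phase is close to an integer *)

Definition indR (P : Prop) : R := if excluded_middle_informative P then 1 else 0.

Lemma count_spaced (Q : nat -> Prop) (H : R) (N : nat) :
  0 < H -> (forall a b, (1 <= a < b)%nat -> Q a -> Q b -> H <= INR b - INR a) ->
  rsum (fun n => indR (Q n)) N <= 1 + INR N / H.
Proof.
  intros HH Hgap.
  (* The induction remembers a point q of [Q] below which all the gaps counted so far, each of
     length at least H, have to fit. *)
  enough (rsum (fun n => indR (Q n)) N <= 0 \/ exists q, (1 <= q <= N)%nat /\ Q q /\
     (rsum (fun n => indR (Q n)) N - 1) * H <= INR q) as E.
  { pose proof (pos_INR N). destruct E as [E|[q [Hq [_ E]]]].
    - assert (0 <= INR N / H) by (apply Rdiv_le_0_compat; lra). lra.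
    - assert (INR q <= INR N) by (apply le_INR; lia).
      apply Rmult_le_reg_r with H; [lra|]. field_simplify; lra. }
  induction N as [|N IH]; [left; simpl; lra|]. cbn [rsum]. unfold indR at 2 4.
  destruct excluded_middle_informative as [HQ|HQ].
  - right. exists (S N). split; [lia|]. split; [easy|].
    destruct IH as [E|[q [Hq [Hqq E]]]].
    + pose proof (pos_INR (S N)). nra.
    + specialize (Hgap q (S N) ltac:(lia) Hqq HQ). lra.
  - rewrite Rplus_0_r. destruct IH as [E|[q [Hq [Hqq E]]]]; [now left|].
    right. exists q. split; [lia|easy].
Qed.

(** Finite type in effective form, ||omega n|| >= c / n^t for every n >= 1, with an integer exponent
    and the division cleared. *)
Definition diophantine (omega c : R) (t : nat) : Prop :=
  forall (n : nat) (j : Z), (1 <= n)%nat -> c <= Rabs (omega * INR n - IZR j) * INR n ^ t.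

(** If two bad points differed by h < H, then ||omega h|| < 2d, against ||omega h|| >= c / h^t. The
    shift cancels in the difference, hence the uniformity in it. *)
Lemma count_not_away (omega c d shift H : R) (t N : nat) :
  0 < c -> 0 < H -> 0 < d -> 2 * d * H ^ t <= c -> diophantine omega c t ->
  rsum (fun n => indR (~ away d (omega * INR n + shift))) N <= 1 + INR N / H.
Proof.
  intros Hc HH Hd Hsmall Hdio. apply count_spaced; [easy|].
  intros a b Hab Ha Hb. unfold away in *.
  apply not_all_ex_not in Ha, Hb. destruct Ha as [j1 H1], Hb as [j2 H2].
  apply Rnot_le_lt in H1, H2. rewrite <- minus_INR by lia.
  destruct (Rle_lt_dec H (INR (b - a))) as [E|E]; [easy|exfalso].
  pose proof (Hdio (b - a)%nat (j2 - j1)%Z ltac:(lia)) as H3.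
  assert (H4 : Rabs (omega * INR (b - a) - IZR (j2 - j1)) < 2 * d).
  { rewrite minus_INR, minus_IZR by lia.
    replace (omega * (INR b - INR a) - (IZR j2 - IZR j1))
      with ((omega * INR b + shift - IZR j2) - (omega * INR a + shift - IZR j1)) by ring.
    unfold Rminus at 1. eapply Rle_lt_trans; [apply Rabs_triang|]. rewrite Rabs_Ropp. lra. }
  pose proof (INR_ge1 (b - a) ltac:(lia)).
  assert (H5 : 0 < INR (b - a) ^ t) by (apply pow_lt; lra).
  assert (H6 : INR (b - a) ^ t <= H ^ t) by (apply pow_incr; lra).
  assert (Rabs (omega * INR (b - a) - IZR (j2 - j1)) * INR (b - a) ^ t
    < 2 * d * INR (b - a) ^ t) by (apply Rmult_lt_compat_r; easy).
  nra.
Qed.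

(** * Logarithmic weighting *)

Lemma INR_div_le (N p : nat) : (1 <= p)%nat -> INR (N / p) <= INR N / INR p.
Proof.
  intros Hp. pose proof (INR_ge1 p Hp).
  apply Rmult_le_reg_r with (INR p); [lra|]. unfold Rdiv.
  rewrite Rmult_assoc, Rinv_l, Rmult_1_r, <- mult_INR by lra.
  apply le_INR. rewrite Nat.mul_comm. apply Nat.Div0.mul_div_le.
Qed.

(** Cauchy-Schwarz with a free parameter: each use picks l to balance the two terms, and no square
    root of a sum has to be handled. *)
Lemma rsum_amgm (a b : nat -> R) (l : R) (N : nat) :
  0 < l ->
  rsum (fun n => a n * b n) N
    <= (l * rsum (fun n => a n ^ 2) N + / l * rsum (fun n => b n ^ 2) N) / 2.
Proof.
  intros Hl. rewrite <- !rsum_scal, <- rsum_plus.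
  unfold Rdiv. rewrite <- rsum_scal_r. apply rsum_le. intros n _.
  assert (H : 0 <= / l * (l * a n - b n) ^ 2).
  { apply Rmult_le_pos; [now apply Rlt_le, Rinv_0_lt_compat|apply pow2_ge_0]. }
  replace (/ l * (l * a n - b n) ^ 2)
    with (l * a n ^ 2 + / l * b n ^ 2 - 2 * (a n * b n)) in H by (field; lra).
  lra.
Qed.

(* The real and imaginary parts [w] of a function in F_A, with [g] its modulus:
   multiplicativity survives as a bilinear relation between [w] and [x_i, y_i]. *)
Record bilinear_split (A : R) (w g x1 x2 y1 y2 : nat -> R) : Prop := {
  bs_A : 1 <= A;
  bs_sqr : forall N, rsum (fun n => g n ^ 2) N <= A ^ 2 * INR N;
  bs_w : forall n, Rabs (w n) <= g n;
  bs_x1 : forall p, nprime p -> Rabs (x1 p) <= A;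
  bs_x2 : forall p, nprime p -> Rabs (x2 p) <= A;
  bs_y1 : forall m, Rabs (y1 m) <= g m;
  bs_y2 : forall m, Rabs (y2 m) <= g m;
  bs_mult : forall p m, nprime p -> (1 <= m)%nat -> ~ Nat.divide p m ->
    w (p * m)%nat = x1 p * y1 m + x2 p * y2 m
}.

Definition exact_divisors_sum (M n : nat) : R :=
  rsum (fun p => if dvd p n && negb (dvd p (n / p)) then lp p else 0) M.

Lemma exact_divisors_sum_le (M n : nat) : (1 <= n)%nat -> exact_divisors_sum M n <= ln (INR n).
Proof.
  intros Hn. eapply Rle_trans; [|now apply (rsum_lp_divisors_le n M)].
  apply rsum_le. intros p Hp. pose proof (lp_nonneg p).
  destruct (dvd p n), (dvd p (n / p)); simpl; lra.
Qed.

(** The defect at n is at most 3 ln d for some d with d^2 | n. Its square is majorised by the sum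
    over all such d, and sum of 9 (ln d)^2 N / d^2 is at most 144 N times the sum of d^(-3/2); 432 =
    3 * 144. *)
Lemma rsum_sqr_log_defect (N : nat) :
  rsum (fun n => (ln (INR n) - exact_divisors_sum N n) ^ 2) N <= 432 * INR N.
Proof.
  destruct N as [|N']; [simpl; lra|]. set (N := S N').
  apply Rle_trans with (rsum (fun n => rsum (fun d =>
     if dvd (d * d) n then 9 * ln (INR d) ^ 2 else 0) N) N).
  - apply rsum_le. intros n Hn.
    pose proof (exact_divisors_sum_le N n ltac:(lia)).
    destruct (ln_le_exact_divisors n ltac:(lia)) as [d [Hd [Hdn Hle]]].
    specialize (Hle N ltac:(lia)). fold (exact_divisors_sum N n) in Hle.
    assert (Hd0 : 0 <= ln (INR d)).
    { rewrite <- ln_1. apply ln_le; [lra|]. now apply INR_ge1. }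
    apply Rle_trans with (9 * ln (INR d) ^ 2); [nra|].
    replace (9 * ln (INR d) ^ 2) with
      ((fun d => if dvd (d * d) n then 9 * ln (INR d) ^ 2 else 0) d).
    2:{ simpl. now rewrite (proj2 (dvd_spec (d * d) n ltac:(nia)) Hdn). }
    apply (rsum_term_le (fun d => if dvd (d * d) n then 9 * ln (INR d) ^ 2 else 0)).
    + intros k _. simpl. destruct (dvd _ _); [|lra]. pose proof (pow2_ge_0 (ln (INR k))). lra.
    + apply Nat.divide_pos_le in Hdn; [nia|lia].
  - rewrite rsum_swap.
    apply Rle_trans with (rsum (fun d => 144 * INR N * / (INR d * sqrt (INR d))) N).
    + apply rsum_le. intros d Hd. rewrite (rsum_multiples (fun _ => 9 * ln (INR d) ^ 2)) by nia.
      rewrite rsum_const. pose proof (INR_div_le N (d * d) ltac:(nia)) as H1.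
      assert (H2 : 1 <= INR d) by (apply INR_ge1; lia).
      pose proof (ln_sq_le (INR d) H2) as H3. rewrite mult_INR in H1.
      assert (Hs : 0 < sqrt (INR d)) by (apply sqrt_lt_R0; lra).
      pose proof (sqrt_sqrt (INR d) ltac:(lra)) as E.
      apply Rle_trans with (9 * (16 * sqrt (INR d)) * (INR N / (INR d * INR d))).
      * apply Rmult_le_compat; [|apply pos_INR| |easy]; [|lra].
        pose proof (pow2_ge_0 (ln (INR d))). lra.
      * right. set (s := sqrt (INR d)) in *. rewrite <- E. field. lra.
    + rewrite rsum_scal. pose proof (rsum_inv_three_halves N ltac:(lia)) as H1.
      assert (0 < sqrt (INR N)) by (apply sqrt_lt_R0; pose proof (INR_ge1 N ltac:(lia)); lra).
      assert (0 < 2 / sqrt (INR N)) by (apply Rdiv_lt_0_compat; lra).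
      pose proof (pos_INR N). nra.
Qed.

Lemma rsum_log_quotient (N : nat) :
  rsum (fun n => (ln (INR N) - ln (INR n)) ^ 2) N <= 32 * INR N.
Proof.
  apply Rle_trans with (rsum (fun n => 16 * sqrt (INR N) * / sqrt (INR n)) N).
  - apply rsum_le. intros n Hn. pose proof (INR_ge1 n ltac:(lia)).
    assert (INR n <= INR N) by (apply le_INR; lia).
    rewrite <- ln_div by lra. rewrite Rmult_assoc. fold (Rdiv (sqrt (INR N)) (sqrt (INR n))).
    rewrite <- sqrt_div by lra. apply ln_sq_le.
    apply Rmult_le_reg_r with (INR n); [lra|]. unfold Rdiv.
    rewrite Rmult_assoc, Rinv_l; lra.
  - rewrite rsum_scal. pose proof (rsum_inv_sqrt N).
    pose proof (sqrt_sqrt (INR N) (pos_INR N)). pose proof (sqrt_pos (INR N)). nra.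
Qed.

Lemma rsum_over_three_halves_le (a : nat -> R) (B : R) (N : nat) :
  0 <= B -> (forall n, (n <= N)%nat -> rsum a n <= B * INR n) ->
  rsum (fun n => a n * / (INR n * sqrt (INR n))) N <= 3 * B.
Proof.
  intros HB H. destruct N as [|N]; [simpl; lra|].
  eapply Rle_trans; [apply (rsum_weight_le a (fun _ => B))|].
  - intros n Hn. rewrite rsum_const. now apply H.
  - intros n Hn. pose proof (INR_ge1 n Hn). rewrite S_INR.
    assert (0 < sqrt (INR n)) by (apply sqrt_lt_R0; lra).
    assert (sqrt (INR n) <= sqrt (INR n + 1)) by (apply sqrt_le_1; lra).
    split; [apply Rlt_le, Rinv_0_lt_compat; nra|apply Rinv_le_contravar; nra].
  - rewrite rsum_scal. pose proof (rsum_inv_three_halves (S N) ltac:(lia)).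
    assert (0 < sqrt (INR (S N))) by (apply sqrt_lt_R0; pose proof (INR_ge1 (S N) ltac:(lia)); lra).
    assert (0 < 2 / sqrt (INR (S N))) by (apply Rdiv_lt_0_compat; lra). nra.
Qed.

Lemma rsum_Rabs_le (a b : nat -> R) (N : nat) :
  (forall n, (1 <= n <= N)%nat -> Rabs (a n) <= b n) -> Rabs (rsum a N) <= rsum b N.
Proof.
  intros H. eapply Rle_trans; [apply rsum_abs|]. now apply rsum_le.
Qed.

(** A prime p divides n exactly when n = pm with m prime to p, so exchanging the sums gives a sum
    over pairs (p, m). *)
Lemma rsum_exact_divisors (F : nat -> R) (N : nat) :
  rsum (fun n => F n * exact_divisors_sum N n) N
  = rsum (fun p => lp p * rsum (fun m => if dvd p m then 0 else F (p * m)%nat) (N / p)) N.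
Proof.
  unfold exact_divisors_sum.
  rewrite (rsum_ext _ (fun n => rsum (fun p =>
    F n * (if dvd p n && negb (dvd p (n / p)) then lp p else 0)) N))
    by (intros; now rewrite rsum_scal).
  rewrite rsum_swap. apply rsum_ext. intros p Hp. rewrite <- rsum_scal.
  rewrite (rsum_ext _ (fun n => if dvd p n then
     F n * (if dvd p (n / p) then 0 else lp p) else 0)).
  2:{ intros n _. destruct (dvd p n), (dvd p (n / p)); simpl; ring. }
  rewrite rsum_multiples by lia. apply rsum_ext. intros m _.
  rewrite Nat.mul_comm, Nat.div_mul, Nat.mul_comm by lia.
  destruct (dvd p m); ring.
Qed.

(** Controls the pairs with p | m, where multiplicativity says nothing. Only N/p^2 integers m occur;
    pairing their indicator with the mean square of [g], with l = p^(-1/2), gives p^(-3/2), whose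
    sum against ln p converges. *)
Lemma rsum_multiples_g_le (A : R) (g : nat -> R) (p N : nat) :
  (forall N, rsum (fun n => g n ^ 2) N <= A ^ 2 * INR N) -> (1 <= p)%nat ->
  rsum (fun m => if dvd p m then g m else 0) (N / p)
    <= (A ^ 2 + 1) / 2 * INR N * / (INR p * sqrt (INR p)).
Proof.
  intros Hg Hp. pose proof (INR_ge1 p Hp) as Hp1.
  assert (Hs : 0 < sqrt (INR p)) by (apply sqrt_lt_R0; lra).
  pose proof (sqrt_sqrt (INR p) ltac:(lra)) as E.
  rewrite (rsum_ext _ (fun m => g m * (if dvd p m then 1 else 0)))
    by (intros m _; destruct (dvd p m); ring).
  eapply Rle_trans; [apply (rsum_amgm _ _ (/ sqrt (INR p)))|].
  { now apply Rinv_0_lt_compat. }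
  rewrite Rinv_inv.
  assert (H1 : rsum (fun n => g n ^ 2) (N / p) <= A ^ 2 * (INR N / INR p)).
  { eapply Rle_trans; [apply Hg|]. apply Rmult_le_compat_l; [apply pow2_ge_0|].
    now apply INR_div_le. }
  assert (H2 : rsum (fun n => (if dvd p n then 1 else 0) ^ 2) (N / p)
      <= INR N / INR p / INR p).
  { rewrite (rsum_ext _ (fun n => if dvd p n then 1 else 0))
      by (intros n _; destruct (dvd p n); ring).
    rewrite (rsum_multiples (fun _ => 1)) by easy. rewrite rsum_const, Rmult_1_l.
    eapply Rle_trans; [now apply INR_div_le|].
    apply Rmult_le_compat_r; [apply Rlt_le, Rinv_0_lt_compat; lra|now apply INR_div_le]. }
  apply Rle_trans with ((/ sqrt (INR p) * (A ^ 2 * (INR N / INR p))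
     + sqrt (INR p) * (INR N / INR p / INR p)) / 2).
  - apply Rmult_le_compat_r; [lra|]. apply Rplus_le_compat; apply Rmult_le_compat_l; try easy; [|lra].
    now apply Rlt_le, Rinv_0_lt_compat.
  - right. set (s := sqrt (INR p)) in *. rewrite <- E. field. lra.
Qed.

Definition bilinear_form (x1 x2 y1 y2 u : nat -> R) (N : nat) : R :=
  rsum (fun p => lp p * rsum (fun m => (x1 p * y1 m + x2 p * y2 m) * u (p * m)%nat) (N / p)) N.

(** The sum of (A^2 + 32)/2 and (A^2 + 432)/2, from the two logarithmic defects, and of 12 A (A^2 +
    1), from the pairs with p | m. *)
Definition log_const (A : R) : R := A ^ 2 + 232 + 12 * A * (A ^ 2 + 1).

Lemma bs_pair_le A w g x1 x2 y1 y2 (p m : nat) :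
  bilinear_split A w g x1 x2 y1 y2 -> nprime p ->
  Rabs (x1 p * y1 m + x2 p * y2 m) <= 2 * A * g m.
Proof.
  intros H Hp. pose proof (bs_x1 _ _ _ _ _ _ _ H p Hp). pose proof (bs_x2 _ _ _ _ _ _ _ H p Hp).
  pose proof (bs_y1 _ _ _ _ _ _ _ H m). pose proof (bs_y2 _ _ _ _ _ _ _ H m).
  eapply Rle_trans; [apply Rabs_triang|]. rewrite !Rabs_mult.
  replace (2 * A * g m) with (A * g m + A * g m) by ring.
  apply Rplus_le_compat; apply Rmult_le_compat; (easy || apply Rabs_pos).
Qed.

Lemma bs_g_nonneg A w g x1 x2 y1 y2 (n : nat) :
  bilinear_split A w g x1 x2 y1 y2 -> 0 <= g n.
Proof.
  intros H. pose proof (bs_w _ _ _ _ _ _ _ H n). pose proof (Rabs_pos (w n)). lra.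
Qed.

Lemma log_weighted_sum A w g x1 x2 y1 y2 (u : nat -> R) (N : nat) :
  bilinear_split A w g x1 x2 y1 y2 -> (forall n, Rabs (u n) <= 1) ->
  Rabs (ln (INR N) * rsum (fun n => w n * u n) N - bilinear_form x1 x2 y1 y2 u N)
  <= log_const A * INR N.
Proof.
  intros H Hu. pose proof (bs_A _ _ _ _ _ _ _ H) as HA.
  pose proof (bs_sqr _ _ _ _ _ _ _ H) as Hg.
  assert (Hg0 : forall n, 0 <= g n) by (intros; eapply bs_g_nonneg; eauto).
  assert (Hwu : forall n, Rabs (w n * u n) <= g n).
  { intros n. rewrite Rabs_mult. pose proof (bs_w _ _ _ _ _ _ _ H n).
    pose proof (Hu n). pose proof (Rabs_pos (w n)). pose proof (Rabs_pos (u n)). nra. }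
  set (E1 := rsum (fun n => w n * u n * (ln (INR N) - ln (INR n))) N).
  set (E2 := rsum (fun n => w n * u n * (ln (INR n) - exact_divisors_sum N n)) N).
  set (E3 := rsum (fun p => lp p * rsum (fun m => if dvd p m then
     (x1 p * y1 m + x2 p * y2 m) * u (p * m)%nat else 0) (N / p)) N).
  (* [ln N] is split into ln N - ln n, the defect of ln n, and the exact divisor sum. The last gives
     the bilinear form without the pairs p | m, which [E3] restores. *)
  assert (E : ln (INR N) * rsum (fun n => w n * u n) N - bilinear_form x1 x2 y1 y2 u N
    = E1 + E2 - E3).
  { assert (F1 : ln (INR N) * rsum (fun n => w n * u n) N
      = E1 + E2 + rsum (fun n => w n * u n * exact_divisors_sum N n) N).
    { unfold E1, E2. rewrite <- rsum_scal, <- !rsum_plus. apply rsum_ext. intros; ring. }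
    rewrite F1, (rsum_exact_divisors (fun n => w n * u n)).
    enough (bilinear_form x1 x2 y1 y2 u N = rsum (fun p => lp p *
       rsum (fun m => if dvd p m then 0 else w (p * m)%nat * u (p * m)%nat) (N / p)) N + E3) by lra.
    unfold E3, bilinear_form. rewrite <- rsum_plus. apply rsum_ext. intros p Hp.
    destruct (prime_dec (Z.of_nat p)) as [Hpp|Hpp]; [|rewrite lp_not_prime by easy; ring].
    rewrite <- Rmult_plus_distr_l, <- rsum_plus. f_equal. apply rsum_ext. intros m Hm.
    dvdP p m; [ring|]. rewrite (bs_mult _ _ _ _ _ _ _ H p m) by (easy || lia). ring. }
  assert (B1 : Rabs E1 <= (A ^ 2 + 32) / 2 * INR N).
  { apply Rle_trans with (rsum (fun n => g n * (ln (INR N) - ln (INR n))) N).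
    - apply rsum_Rabs_le. intros n Hn. rewrite Rabs_mult.
      assert (ln (INR n) <= ln (INR N)).
      { apply ln_le; [pose proof (INR_ge1 n ltac:(lia)); lra|apply le_INR; lia]. }
      rewrite (Rabs_pos_eq (ln _ - _)) by lra. apply Rmult_le_compat_r; [lra|easy].
    - eapply Rle_trans; [apply (rsum_amgm _ _ 1); lra|].
      pose proof (Hg N). pose proof (rsum_log_quotient N). rewrite Rinv_1. lra. }
  assert (B2 : Rabs E2 <= (A ^ 2 + 432) / 2 * INR N).
  { apply Rle_trans with (rsum (fun n => g n * (ln (INR n) - exact_divisors_sum N n)) N).
    - apply rsum_Rabs_le. intros n Hn. rewrite Rabs_mult.
      pose proof (exact_divisors_sum_le N n ltac:(lia)).
      rewrite (Rabs_pos_eq (ln _ - _)) by lra. apply Rmult_le_compat_r; [lra|easy].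
    - eapply Rle_trans; [apply (rsum_amgm _ _ 1); lra|].
      pose proof (Hg N). pose proof (rsum_sqr_log_defect N). rewrite Rinv_1. lra. }
  assert (B3 : Rabs E3 <= 12 * A * (A ^ 2 + 1) * INR N).
  { pose proof (pos_INR N) as HN.
    apply Rle_trans with (rsum (fun p => (A * (A ^ 2 + 1) * INR N) *
        (lp p * / (INR p * sqrt (INR p)))) N).
    - apply rsum_Rabs_le. intros p Hp. rewrite Rabs_mult, (Rabs_pos_eq (lp p)) by apply lp_nonneg.
      destruct (prime_dec (Z.of_nat p)) as [Hpp|Hpp]; [|rewrite lp_not_prime by easy; lra].
      pose proof (rsum_multiples_g_le A g p N Hg ltac:(lia)) as H1.
      enough (Rabs (rsum (fun m => if dvd p m then
        (x1 p * y1 m + x2 p * y2 m) * u (p * m)%nat else 0) (N / p))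
        <= 2 * A * rsum (fun m => if dvd p m then g m else 0) (N / p)) as H2.
      { pose proof (lp_nonneg p). assert (1 <= INR p) by (apply INR_ge1; lia).
        assert (0 < sqrt (INR p)) by (apply sqrt_lt_R0; lra).
        replace (A * (A ^ 2 + 1) * INR N * (lp p * / (INR p * sqrt (INR p))))
          with (lp p * (2 * A * ((A ^ 2 + 1) / 2 * INR N * / (INR p * sqrt (INR p)))))
          by (field; lra).
        apply Rmult_le_compat_l; [easy|]. eapply Rle_trans; [exact H2|].
        apply Rmult_le_compat_l; lra. }
      rewrite <- rsum_scal. apply rsum_Rabs_le. intros m _.
      destruct (dvd p m); [|rewrite Rabs_R0; lra]. rewrite Rabs_mult.
      pose proof (bs_pair_le _ _ _ _ _ _ _ p m H Hpp). pose proof (Hu (p * m)%nat).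
      pose proof (Rabs_pos (x1 p * y1 m + x2 p * y2 m)). pose proof (Rabs_pos (u (p * m)%nat)). nra.
    - rewrite rsum_scal.
      pose proof (rsum_over_three_halves_le lp 4 N ltac:(lra) (fun n _ => theta_le n)) as H1.
      assert (0 <= A * (A ^ 2 + 1) * INR N).
      { repeat apply Rmult_le_pos; [lra| |lra]. pose proof (pow2_ge_0 A). lra. }
      nra. }
  rewrite E. unfold log_const. unfold Rminus at 1.
  eapply Rle_trans; [apply Rabs_triang|]. rewrite Rabs_Ropp.
  pose proof (Rabs_triang E1 E2). lra.
Qed.

(** * The bilinear sum *)

Definition middle (D N p : nat) : bool := (D <? p) && (p * D <=? N).

Definition middle_form (x y u : nat -> R) (D N : nat) : R :=
  rsum (fun p => if middle D N p
    then lp p * x p * rsum (fun m => y m * u (p * m)%nat) (N / p) else 0) N.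

Lemma rsum_g_le (A : R) (g : nat -> R) (N : nat) :
  0 < A -> (forall N, rsum (fun n => g n ^ 2) N <= A ^ 2 * INR N) -> rsum g N <= A * INR N.
Proof.
  intros HA Hg. rewrite (rsum_ext g (fun n => g n * 1)) by (intros; ring).
  eapply Rle_trans; [apply (rsum_amgm g (fun _ => 1) (/ A)); now apply Rinv_0_lt_compat|].
  rewrite Rinv_inv, rsum_const. specialize (Hg N).
  assert (/ A * rsum (fun n => g n ^ 2) N <= A * INR N).
  { apply Rle_trans with (/ A * (A ^ 2 * INR N)).
    - apply Rmult_le_compat_l; [now apply Rlt_le, Rinv_0_lt_compat|easy].
    - right. field. lra. }
  lra.
Qed.

Lemma rsum_small_primes_le (A : R) (g : nat -> R) (D N : nat) :
  0 < A -> (forall n, 0 <= g n) ->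
  (forall N, rsum (fun n => g n ^ 2) N <= A ^ 2 * INR N) ->
  rsum (fun p => if p <=? D then lp p * rsum g (N / p) else 0) N <= 4 * A * INR N * harm D.
Proof.
  intros HA Hg0 Hg.
  (* D may exceed N, so the range is lengthened to N + D before it is truncated at D. *)
  apply Rle_trans with
    (rsum (fun p => if p <=? D then lp p * rsum g (N / p) else 0) (N + D)).
  { apply rsum_le_extend; [lia|]. intros n Hn. destruct (n <=? D); [|lra].
    apply Rmult_le_pos; [apply lp_nonneg|apply rsum_nonneg; intros; apply Hg0]. }
  rewrite (rsum_truncate (fun p => lp p * rsum g (N / p))) by lia.
  apply Rle_trans with (rsum (fun p => A * INR N * (lp p * / INR p)) D).
  - apply rsum_le. intros p Hp.
    replace (A * INR N * (lp p * / INR p)) with (lp p * (A * (INR N / INR p)))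
      by (unfold Rdiv; ring).
    apply Rmult_le_compat_l; [apply lp_nonneg|].
    eapply Rle_trans; [now apply (rsum_g_le A)|].
    apply Rmult_le_compat_l; [lra|]. apply INR_div_le; lia.
  - rewrite rsum_scal. pose proof (rsum_lp_over_p_le D). pose proof (pos_INR N).
    assert (0 <= A * INR N) by (apply Rmult_le_pos; lra). nra.
Qed.

(** When pD > N, every m <= N/p is below D. With m outside, Chebyshev bounds the primes p <= N/m by
    4N/m, and the sum of g(m)/m over m <= D is at most A [harm D]. *)
Lemma rsum_large_primes_le (A : R) (g : nat -> R) (D N : nat) :
  0 < A -> (forall n, 0 <= g n) ->
  (forall N, rsum (fun n => g n ^ 2) N <= A ^ 2 * INR N) ->
  rsum (fun p => if N <? p * D then lp p * rsum g (N / p) else 0) N <= 4 * A * INR N * harm D.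
Proof.
  intros HA Hg0 Hg.
  apply Rle_trans with (rsum (fun p => rsum (fun m =>
    if m <=? D then g m * (if p * m <=? N then lp p else 0) else 0) N) N).
  { apply rsum_le. intros p Hp.
    assert (H0 : forall m, 0 <= (if m <=? D then g m * (if p * m <=? N then lp p else 0) else 0)).
    { intros m. destruct (m <=? D); [|lra]. apply Rmult_le_pos; [easy|].
      destruct (_ <=? _); [apply lp_nonneg|lra]. }
    destruct (Nat.ltb_spec N (p * D)) as [H|H]; [|apply rsum_nonneg; intros; apply H0].
    rewrite rsum_quot, <- rsum_scal by lia. apply rsum_le. intros m Hm.
    destruct (Nat.leb_spec (m * p) N) as [H1|H1]; [|rewrite Rmult_0_r; apply H0].
    destruct (Nat.leb_spec m D) as [H2|H2]; [|nia].
    destruct (Nat.leb_spec (p * m) N) as [H3|H3]; [lra|nia]. }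
  rewrite rsum_swap.
  apply Rle_trans with (rsum (fun m => if m <=? D then 4 * INR N * (g m * / INR m) else 0) N).
  { apply rsum_le. intros m Hm. destruct (m <=? D); [|rewrite rsum_0; lra].
    rewrite rsum_scal, <- rsum_quot by lia.
    replace (4 * INR N * (g m * / INR m)) with (g m * (4 * (INR N / INR m)))
      by (unfold Rdiv; ring).
    apply Rmult_le_compat_l; [easy|]. eapply Rle_trans; [apply theta_le|].
    apply Rmult_le_compat_l; [lra|]. apply INR_div_le; lia. }
  assert (H0 : forall m, (1 <= m)%nat -> 0 <= g m * / INR m).
  { intros m Hm. apply Rmult_le_pos; [easy|]. pose proof (INR_ge1 m Hm).
    apply Rlt_le, Rinv_0_lt_compat; lra. }
  apply Rle_trans with
    (rsum (fun m => if m <=? D then 4 * INR N * (g m * / INR m) else 0) (N + D)).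
  { apply rsum_le_extend; [lia|]. intros m Hm. destruct (m <=? D); [|lra].
    specialize (H0 m Hm). pose proof (pos_INR N). nra. }
  rewrite (rsum_truncate (fun m => 4 * INR N * (g m * / INR m))) by lia.
  rewrite rsum_scal.
  pose proof (rsum_over_n_le g A D (fun n _ => rsum_g_le A g n HA Hg)).
  pose proof (pos_INR N). nra.
Qed.

Lemma bilinear_form_middle A w g x1 x2 y1 y2 (u : nat -> R) (D N : nat) :
  bilinear_split A w g x1 x2 y1 y2 -> (forall n, Rabs (u n) <= 1) ->
  Rabs (bilinear_form x1 x2 y1 y2 u N
        - (middle_form x1 y1 u D N + middle_form x2 y2 u D N))
  <= 16 * A ^ 2 * INR N * harm D.
Proof.
  intros H Hu. pose proof (bs_A _ _ _ _ _ _ _ H) as HA.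
  pose proof (bs_sqr _ _ _ _ _ _ _ H) as Hg.
  assert (Hg0 : forall n, 0 <= g n) by (intros; eapply bs_g_nonneg; eauto).
  unfold bilinear_form, middle_form. rewrite <- rsum_plus, <- rsum_minus.
  (* The two outer ranges overlap when D is large; both majorants are nonnegative, so counting a
     prime twice is harmless. *)
  apply Rle_trans with (rsum (fun p => 2 * A *
    ((if p <=? D then lp p * rsum g (N / p) else 0)
     + (if N <? p * D then lp p * rsum g (N / p) else 0))) N).
  - apply rsum_Rabs_le. intros p Hp.
    assert (Hlg : 0 <= lp p * rsum g (N / p)).
    { apply Rmult_le_pos; [apply lp_nonneg|]. apply rsum_nonneg; intros; apply Hg0. }
    destruct (middle D N p) eqn:Em.
    + rewrite (rsum_ext _ (fun m => x1 p * (y1 m * u (p * m)%nat) + x2 p * (y2 m * u (p * m)%nat)))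
        by (intros; ring).
      rewrite rsum_plus, !rsum_scal, Rmult_plus_distr_l, <- !Rmult_assoc, Rminus_diag, Rabs_R0.
      destruct (p <=? D), (N <? p * D); nra.
    + rewrite Rplus_0_l, Rminus_0_r.
      apply Rle_trans with (2 * A * (lp p * rsum g (N / p))).
      * rewrite Rabs_mult, (Rabs_pos_eq (lp p)) by apply lp_nonneg.
        destruct (prime_dec (Z.of_nat p)) as [Hpp|Hpp]; [|rewrite lp_not_prime by easy; lra].
        replace (2 * A * (lp p * rsum g (N / p))) with (lp p * (2 * A * rsum g (N / p))) by ring.
        apply Rmult_le_compat_l; [apply lp_nonneg|]. rewrite <- rsum_scal.
        apply rsum_Rabs_le. intros m _. rewrite Rabs_mult.
        pose proof (bs_pair_le _ _ _ _ _ _ _ p m H Hpp). pose proof (Hu (p * m)%nat).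
        pose proof (Rabs_pos (x1 p * y1 m + x2 p * y2 m)). pose proof (Rabs_pos (u (p * m)%nat)). nra.
      * apply Rmult_le_compat_l; [lra|]. unfold middle in Em.
        apply andb_false_iff in Em.
        destruct (Nat.leb_spec p D), (Nat.ltb_spec N (p * D)); try lra.
        destruct Em as [Em|Em]; [apply Nat.ltb_ge in Em|apply Nat.leb_gt in Em]; lia.
  - rewrite rsum_scal, rsum_plus.
    pose proof (rsum_small_primes_le A g D N ltac:(lra) Hg0 Hg).
    pose proof (rsum_large_primes_le A g D N ltac:(lra) Hg0 Hg). nra.
Qed.

(** Lets [e] be large on a sparse set: only its mean square enters. Collecting the terms with pm = n
    weights e(n)^2 by the sum of ln p over p | n, which is at most ln N. *)
Lemma middle_form_error_le (A l : R) (g x y e : nat -> R) (D N : nat) :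
  1 <= A -> 0 < l -> (forall N, rsum (fun n => g n ^ 2) N <= A ^ 2 * INR N) ->
  (forall p, nprime p -> Rabs (x p) <= A) -> (forall m, Rabs (y m) <= g m) ->
  Rabs (middle_form x y e D N)
  <= A / 2 * (l * (4 * A ^ 2 * INR N * harm N)
              + / l * (ln (INR N) * rsum (fun n => e n ^ 2) N)).
Proof.
  intros HA Hl Hg Hx Hy. pose proof (Rinv_0_lt_compat l Hl) as Hl'.
  apply Rle_trans with (rsum (fun p => A / 2 * (l * (A ^ 2 * INR N) * (lp p * / INR p)
     + / l * (lp p * rsum (fun m => e (p * m)%nat ^ 2) (N / p)))) N).
  - apply rsum_Rabs_le. intros p Hp. pose proof (INR_ge1 p ltac:(lia)) as Hp1.
    pose proof (lp_nonneg p) as Hlp.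
    assert (He : 0 <= rsum (fun m => e (p * m)%nat ^ 2) (N / p))
      by (apply rsum_nonneg; intros; apply pow2_ge_0).
    pose proof (Rinv_0_lt_compat (INR p) ltac:(lra)) as Hip.
    pose proof (pos_INR N) as HN. pose proof (pow2_ge_0 A) as HA2.
    replace (A / 2 * (l * (A ^ 2 * INR N) * (lp p * / INR p) + / l * (lp p * rsum (fun m => e (p * m)%nat ^ 2) (N / p))))
      with (lp p * (A * ((l * (A ^ 2 * (INR N / INR p)) + / l * rsum (fun m => e (p * m)%nat ^ 2) (N / p)) / 2)))
      by (field; lra).
    assert (Hpos : 0 <= (l * (A ^ 2 * (INR N / INR p)) + / l * rsum (fun m => e (p * m)%nat ^ 2) (N / p)) / 2).
    { assert (0 <= l * (A ^ 2 * (INR N / INR p)))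
        by (unfold Rdiv; repeat apply Rmult_le_pos; lra).
      assert (0 <= / l * rsum (fun m => e (p * m)%nat ^ 2) (N / p)) by (apply Rmult_le_pos; lra).
      lra. }
    destruct (middle D N p).
    2:{ rewrite Rabs_R0. repeat apply Rmult_le_pos; lra. }
    destruct (prime_dec (Z.of_nat p)) as [Hpp|Hpp]; [|rewrite lp_not_prime, !Rmult_0_l, Rabs_R0 by easy; lra].
    rewrite Rmult_assoc, Rabs_mult, (Rabs_pos_eq (lp p)) by easy.
    apply Rmult_le_compat_l; [easy|]. rewrite Rabs_mult.
    apply Rmult_le_compat; [apply Rabs_pos|apply Rabs_pos|now apply Hx|].
    apply Rle_trans with (rsum (fun m => g m * Rabs (e (p * m)%nat)) (N / p)).
    + apply rsum_Rabs_le. intros m _. rewrite Rabs_mult.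
      apply Rmult_le_compat_r; [apply Rabs_pos|easy].
    + eapply Rle_trans; [now apply (rsum_amgm _ _ l)|].
      rewrite (rsum_ext (fun n => Rabs (e (p * n)%nat) ^ 2) (fun n => e (p * n)%nat ^ 2))
        by (intros; now rewrite RPow_abs, Rabs_pos_eq by apply pow2_ge_0).
      apply Rmult_le_compat_r; [lra|]. apply Rplus_le_compat_r, Rmult_le_compat_l; [lra|].
      eapply Rle_trans; [apply Hg|]. apply Rmult_le_compat_l; [easy|]. apply INR_div_le; lia.
  - rewrite rsum_scal, rsum_plus, !rsum_scal.
    apply Rmult_le_compat_l; [lra|]. apply Rplus_le_compat.
    + pose proof (rsum_lp_over_p_le N). pose proof (pos_INR N). pose proof (pow2_ge_0 A).
      assert (0 <= l * (A ^ 2 * INR N)) by (repeat apply Rmult_le_pos; lra). nra.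
    + apply Rmult_le_compat_l; [lra|]. rewrite <- rsum_scal.
      rewrite (rsum_ext _ (fun p => rsum (fun n => if dvd p n then lp p * e n ^ 2 else 0) N)).
      2:{ intros p Hp. rewrite (rsum_multiples (fun n => lp p * e n ^ 2)) by lia.
          now rewrite <- rsum_scal. }
      rewrite rsum_swap. apply rsum_le. intros n Hn.
      rewrite (rsum_ext _ (fun p => (if dvd p n then lp p else 0) * e n ^ 2))
        by (intros; destruct (dvd _ _); ring).
      rewrite rsum_scal_r. apply Rmult_le_compat_r; [apply pow2_ge_0|].
      eapply Rle_trans; [apply rsum_lp_divisors_le; lia|].
      apply ln_le; [|apply le_INR; lia]. pose proof (INR_ge1 n ltac:(lia)). lra.
Qed.

(** The right side is the squared modulus of the sum of a(p) exp(i th(p)), of which the left side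
    keeps the imaginary part. Passing to the modulus leaves only differences of phases. *)
Lemma sqr_rsum_sin_le (a th : nat -> R) (N : nat) :
  rsum (fun p => a p * sin (th p)) N ^ 2
  <= rsum (fun p => rsum (fun q => a p * a q * cos (th p - th q)) N) N.
Proof.
  rewrite (rsum_ext (fun p => rsum _ N) (fun p =>
    a p * sin (th p) * rsum (fun q => a q * sin (th q)) N
    + a p * cos (th p) * rsum (fun q => a q * cos (th q)) N)).
  2:{ intros p _. rewrite <- !rsum_scal, <- rsum_plus. apply rsum_ext. intros q _.
      rewrite cos_minus. ring. }
  rewrite rsum_plus, !rsum_scal_r.
  pose proof (pow2_ge_0 (rsum (fun q => a q * cos (th q)) N)). lra.
Qed.

(** Ordering the pair by q <= p makes the condition qm <= N a consequence of pm <= N. *)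
Lemma rsum_symmetric (F : nat -> nat -> R) (N : nat) :
  (forall p q, F p q = F q p) ->
  rsum (fun p => rsum (F p) N) N = rsum (fun p => 2 * rsum (F p) (p - 1) + F p p) N.
Proof.
  intros HF. induction N as [|N IH]; [easy|]. cbn [rsum].
  rewrite <- IH. replace (S N - 1)%nat with N by lia. rewrite rsum_plus.
  rewrite (rsum_ext (fun n => F n (S N)) (F (S N))) by (intros; apply HF). ring.
Qed.

Lemma rsum_rev (f : nat -> R) (n : nat) : rsum (fun q => f (S n - q)%nat) n = rsum f n.
Proof.
  induction n as [|n IH]; [easy|].
  assert (H : forall h k, rsum h (S k) = h 1%nat + rsum (fun i => h (S i)) k).
  { intros h k. induction k as [|k IHk]; [simpl; ring|].
    change (rsum h (S (S k))) with (rsum h (S k) + h (S (S k))). rewrite IHk. cbn [rsum]. ring. }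
  rewrite H. replace (S (S n) - 1)%nat with (S n) by lia.
  rewrite (rsum_ext (fun i => f (S (S n) - S i)%nat) (fun q => f (S n - q)%nat))
    by (intros; f_equal; lia).
  rewrite IH. cbn [rsum]. ring.
Qed.

(** For ||omega h|| >= d the sum over m is at most X/d <= X^2/H. At most 1 + p/H values of h remain,
    and each is bounded trivially by X^2. *)
Lemma rsum_m_cos_average (omega c d H : R) (t X p : nat) :
  0 < c -> 0 < H -> 0 < d -> 2 * d * H ^ t <= c -> diophantine omega c t ->
  H <= d * INR X ->
  rsum (fun h => Rabs (rsum (fun m => INR m * cos (INR m * (2 * PI * (omega * INR h)))) X)) p
  <= INR X ^ 2 * (1 + 2 * INR p / H).
Proof.
  intros Hc HH Hd Hs Hdio HX.
  assert (HX0 : 0 < INR X) by nra.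
  apply Rle_trans with (rsum (fun h => INR X ^ 2 * indR (~ away d (omega * INR h + 0))
     + INR X ^ 2 / H) p).
  - apply rsum_le. intros h Hh. unfold indR.
    assert (0 <= INR X ^ 2 / H) by (apply Rdiv_le_0_compat; [apply pow2_ge_0|easy]).
    destruct excluded_middle_informative as [Hn|Hn].
    + eapply Rle_trans; [apply rsum_m_cos_trivial|]. lra.
    + apply NNPP in Hn. rewrite Rplus_0_r in Hn.
      pose proof (away_sin d _ ltac:(lra) Hn) as H1.
      pose proof (rsum_m_cos_le (2 * PI * (omega * INR h)) X) as H2.
      replace (2 * PI * (omega * INR h) / 2) with (PI * (omega * INR h)) in H2 by field.
      set (G := Rabs (rsum _ X)) in *. assert (HG : 0 <= G) by apply Rabs_pos.
      assert (H3 : d * G <= INR X) by nra.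
      rewrite Rmult_0_r, Rplus_0_l. apply Rmult_le_reg_l with H; [easy|].
      replace (H * (INR X ^ 2 / H)) with (INR X ^ 2) by (field; lra). nra.
  - rewrite rsum_plus, rsum_scal, rsum_const.
    pose proof (count_not_away omega c d 0 H t p Hc HH Hd Hs Hdio) as H1.
    replace (INR X ^ 2 * (1 + 2 * INR p / H))
      with (INR X ^ 2 * (1 + INR p / H) + INR X ^ 2 / H * INR p) by (field; lra).
    apply Rplus_le_compat_r, Rmult_le_compat_l; [apply pow2_ge_0|easy].
Qed.

Lemma middle_spec (D N p : nat) : middle D N p = true <-> (D < p)%nat /\ (p * D <= N)%nat.
Proof. unfold middle. now rewrite andb_true_iff, Nat.ltb_lt, Nat.leb_le. Qed.

(** Open the square and sum over m first, with h = p - q. For fixed p the total is at most B^2 X^2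
    (3 + 4p/H), where X = N/p, hence at most 7 B^2 N^2 / (pH); the sum over p produces [harm N]. *)
Lemma rsum_m_sqr_rsum_sin_le (b : nat -> R) (B omega shift c d H : R) (t D N : nat) :
  0 < c -> 0 < H -> 0 < d <= 1 -> 2 * d * H ^ t <= c -> diophantine omega c t ->
  H <= d * INR D ->
  (forall p, (1 <= p <= N)%nat -> Rabs (b p) <= B) ->
  (forall p, middle D N p = false -> b p = 0) ->
  rsum (fun m => INR m * rsum (fun p => if p * m <=? N
      then b p * sin (2 * PI * (omega * INR (p * m) + shift)) else 0) N ^ 2) N
  <= 7 * B ^ 2 * INR N ^ 2 * harm N / H.
Proof.
  intros Hc HH Hd Hs Hdio HD Hb Hmid.
  set (F := fun p q => rsum (fun m => if (p * m <=? N) && (q * m <=? N)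
     then b p * b q * (INR m * cos (INR m * (2 * PI * (omega * (INR p - INR q))))) else 0) N).
  apply Rle_trans with (rsum (fun p => rsum (F p) N) N).
  { apply Rle_trans with (rsum (fun m => rsum (fun p => rsum (fun q =>
      if (p * m <=? N) && (q * m <=? N) then
      b p * b q * (INR m * cos (INR m * (2 * PI * (omega * (INR p - INR q))))) else 0) N) N) N).
    - apply rsum_le. intros m Hm.
      apply Rle_trans with (INR m * rsum (fun p => rsum (fun q =>
         (if p * m <=? N then b p else 0) * (if q * m <=? N then b q else 0) *
         cos (2 * PI * (omega * INR (p * m) + shift) - 2 * PI * (omega * INR (q * m) + shift))) N) N).
      + apply Rmult_le_compat_l; [apply pos_INR|].
        rewrite (rsum_ext (fun p => if p * m <=? N then _ else 0) (fun p =>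
          (if p * m <=? N then b p else 0) * sin (2 * PI * (omega * INR (p * m) + shift))))
          by (intros; destruct (_ <=? _); ring).
        apply (sqr_rsum_sin_le (fun p => if p * m <=? N then b p else 0)).
      + right. rewrite <- rsum_scal. apply rsum_ext. intros p _.
        rewrite <- rsum_scal. apply rsum_ext. intros q _.
        rewrite !mult_INR.
        replace (2 * PI * (omega * (INR p * INR m) + shift) - 2 * PI * (omega * (INR q * INR m) + shift))
          with (INR m * (2 * PI * (omega * (INR p - INR q)))) by ring.
        destruct (p * m <=? N), (q * m <=? N); simpl; ring.
    - right. rewrite rsum_swap. apply rsum_ext. intros p _. apply rsum_swap. }
  rewrite rsum_symmetric.
  2:{ intros p q. unfold F. apply rsum_ext. intros m _. rewrite andb_comm.
      destruct (_ && _); [|easy].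
      replace (INR m * (2 * PI * (omega * (INR q - INR p))))
        with (- (INR m * (2 * PI * (omega * (INR p - INR q))))) by ring.
      rewrite cos_neg. ring. }
  apply Rle_trans with (rsum (fun p => 7 * B ^ 2 * INR N ^ 2 / H * / INR p) N).
  2:{ rewrite rsum_scal. fold (harm N). right. field. lra. }
  apply rsum_le. intros p Hp. pose proof (INR_ge1 p ltac:(lia)) as Hp1.
  assert (Hpos : 0 <= 7 * B ^ 2 * INR N ^ 2 / H * / INR p).
  { unfold Rdiv. pose proof (Rinv_0_lt_compat H HH).
    pose proof (Rinv_0_lt_compat (INR p) ltac:(lra)).
    replace (7 * B ^ 2 * INR N ^ 2 * / H * / INR p)
      with (7 * ((B * INR N) ^ 2 * (/ H * / INR p))) by ring.
    apply Rmult_le_pos; [lra|]. apply Rmult_le_pos; [apply pow2_ge_0|].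
    apply Rlt_le, Rmult_lt_0_compat; easy. }
  destruct (middle D N p) eqn:Em.
  2:{ assert (F0 : forall q, F p q = 0).
      { intros q. unfold F. rewrite (rsum_ext _ (fun _ => 0)); [apply rsum_0|].
        intros m _. rewrite (Hmid p Em). destruct (_ && _); ring. }
      rewrite F0, (rsum_ext _ (fun _ => 0)), rsum_0 by (intros; apply F0). lra. }
  apply middle_spec in Em. set (X := (N / p)%nat).
  set (G := fun h => Rabs (rsum (fun m => INR m * cos (INR m * (2 * PI * (omega * INR h)))) X)).
  (* The upper cut-off pD <= N is spent here: it gives H <= d X. *)
  assert (HX : (D <= X)%nat) by (apply Nat.div_le_lower_bound; lia).
  assert (HB : 0 <= B) by (pose proof (Hb p Hp); pose proof (Rabs_pos (b p)); lra).
  assert (HF : forall q, (1 <= q <= p)%nat -> F p q <= B ^ 2 * G (p - q)%nat).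
  { intros q Hq. unfold F.
    rewrite (rsum_ext _ (fun m => if m * p <=? N
      then b p * b q * (INR m * cos (INR m * (2 * PI * (omega * INR (p - q))))) else 0)).
    2:{ intros m _. rewrite (minus_INR p q) by lia. rewrite (Nat.mul_comm p m).
        destruct (Nat.leb_spec (m * p) N); [|easy].
        destruct (Nat.leb_spec (q * m) N); [easy|nia]. }
    rewrite <- (rsum_quot (fun m => b p * b q * (INR m * cos (INR m * (2 * PI * (omega * INR (p - q)))))))
      by lia.
    rewrite rsum_scal. eapply Rle_trans; [apply Rle_abs|]. rewrite !Rabs_mult. fold X.
    fold (G (p - q)%nat). apply Rmult_le_compat_r; [apply Rabs_pos|].
    replace (B ^ 2) with (B * B) by ring.
    apply Rmult_le_compat; try apply Rabs_pos; apply Hb; lia. }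
  assert (HG : rsum G (p - 1) <= INR X ^ 2 * (1 + 2 * INR (p - 1) / H)).
  { apply (rsum_m_cos_average omega c d H t X); try easy.
    apply le_INR in HX. nra. }
  assert (HFs : rsum (F p) (p - 1) <= B ^ 2 * rsum G (p - 1)).
  { rewrite <- rsum_scal. destruct p as [|n]; [lia|].
    replace (S n - 1)%nat with n by lia.
    rewrite <- (rsum_rev (fun q => B ^ 2 * G q)). apply rsum_le. intros q Hq. apply HF. lia. }
  assert (HFp : F p p <= B ^ 2 * INR X ^ 2).
  { eapply Rle_trans; [apply HF; lia|]. apply Rmult_le_compat_l; [apply pow2_ge_0|].
    apply rsum_m_cos_trivial. }
  assert (HXN : INR X <= INR N / INR p) by (apply INR_div_le; lia).
  (* The lower cut-off p > D is spent here: H <= d D <= p lets 3p/H absorb the diagonal and the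
     exceptional 1. *)
  assert (HHp : H <= INR p).
  { assert (INR D <= INR p) by (apply le_INR; lia). pose proof (pos_INR D). nra. }
  assert (HX2 : INR X ^ 2 <= INR N ^ 2 * / INR p ^ 2).
  { replace (INR N ^ 2 * / INR p ^ 2) with ((INR N / INR p) ^ 2) by (field; lra).
    apply pow_incr. split; [apply pos_INR|easy]. }
  assert (Hp' : INR (p - 1) <= INR p) by (apply le_INR; lia).
  assert (HX0 : 0 <= INR X ^ 2) by apply pow2_ge_0.
  assert (Hfac : 3 + 4 * INR (p - 1) / H <= 7 * INR p / H).
  { apply Rmult_le_reg_r with H; [easy|]. field_simplify; lra. }
  assert (Hfac0 : 0 <= 3 + 4 * INR (p - 1) / H).
  { assert (0 <= INR (p - 1) / H) by (apply Rdiv_le_0_compat; [apply pos_INR|easy]). lra. }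
  assert (HB2 : 0 <= B ^ 2) by apply pow2_ge_0.
  apply Rle_trans with (B ^ 2 * (INR X ^ 2 * (3 + 4 * INR (p - 1) / H))).
  - assert (B ^ 2 * rsum G (p - 1) <= B ^ 2 * (INR X ^ 2 * (1 + 2 * INR (p - 1) / H)))
      by (apply Rmult_le_compat_l; easy).
    replace (B ^ 2 * (INR X ^ 2 * (3 + 4 * INR (p - 1) / H)))
      with (2 * (B ^ 2 * (INR X ^ 2 * (1 + 2 * INR (p - 1) / H))) + B ^ 2 * INR X ^ 2) by (field; lra).
    lra.
  - replace (7 * B ^ 2 * INR N ^ 2 / H * / INR p)
      with (B ^ 2 * (INR N ^ 2 * / INR p ^ 2 * (7 * INR p / H))) by (field; lra).
    apply Rmult_le_compat_l; [easy|]. apply Rmult_le_compat; easy.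
Qed.

(** Cauchy-Schwarz in m after inserting sqrt m. The sum over p attached to m has trivial size about
    N/m, so the weight m spreads both g(m)^2 / m and m Z(m)^2 evenly over dyadic ranges, at the cost
    of a factor [harm N]. *)
Lemma middle_form_sin_le (A l omega shift c d H : R) (g x y : nat -> R) (t D N : nat) :
  0 < c -> 0 < H -> 0 < d <= 1 -> 2 * d * H ^ t <= c -> diophantine omega c t ->
  H <= d * INR D -> 1 <= A -> 0 < l ->
  (forall N, rsum (fun n => g n ^ 2) N <= A ^ 2 * INR N) ->
  (forall p, nprime p -> Rabs (x p) <= A) -> (forall m, Rabs (y m) <= g m) ->
  Rabs (middle_form x y (fun n => sin (2 * PI * (omega * INR n + shift))) D N)
  <= (l * (A ^ 2 * harm N)
      + / l * (7 * (A * ln (INR N)) ^ 2 * INR N ^ 2 * harm N / H)) / 2.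
Proof.
  intros Hc HH Hd Hs Hdio HD HA Hl Hg Hx Hy.
  set (b := fun p => if middle D N p then lp p * x p else 0).
  set (Z := fun m => rsum (fun p => if p * m <=? N
      then b p * sin (2 * PI * (omega * INR (p * m) + shift)) else 0) N).
  assert (E : middle_form x y (fun n => sin (2 * PI * (omega * INR n + shift))) D N
    = rsum (fun m => y m * Z m) N).
  { unfold Z. rewrite (rsum_ext (fun m => y m * _) (fun m => rsum (fun p => if p * m <=? N
      then y m * (b p * sin (2 * PI * (omega * INR (p * m) + shift))) else 0) N)).
    2:{ intros m _. rewrite <- rsum_scal. apply rsum_ext. intros p _. destruct (_ <=? _); ring. }
    rewrite rsum_swap. apply rsum_ext. intros p Hp. unfold b.
    destruct (middle D N p).
    - rewrite rsum_quot, <- rsum_scal by lia. apply rsum_ext. intros m _.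
      rewrite (Nat.mul_comm p m). destruct (_ <=? _); ring.
    - rewrite (rsum_ext _ (fun _ => 0)), rsum_0; [easy|]. intros; destruct (_ <=? _); ring. }
  rewrite E.
  apply Rle_trans with (rsum (fun m => (g m * / sqrt (INR m)) * (sqrt (INR m) * Rabs (Z m))) N).
  { apply rsum_Rabs_le. intros m Hm. pose proof (INR_ge1 m ltac:(lia)).
    assert (0 < sqrt (INR m)) by (apply sqrt_lt_R0; lra).
    replace (g m * / sqrt (INR m) * (sqrt (INR m) * Rabs (Z m))) with (g m * Rabs (Z m))
      by (field; lra).
    rewrite Rabs_mult. apply Rmult_le_compat_r; [apply Rabs_pos|easy]. }
  eapply Rle_trans; [now apply (rsum_amgm _ _ l)|].
  apply Rmult_le_compat_r; [lra|]. apply Rplus_le_compat; apply Rmult_le_compat_l.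
  - lra.
  - rewrite (rsum_ext _ (fun m => g m ^ 2 * / INR m)).
    + apply rsum_over_n_le. intros; apply Hg.
    + intros m Hm. pose proof (INR_ge1 m ltac:(lia)).
      rewrite Rpow_mult_distr, pow_inv, pow2_sqrt by lra. easy.
  - now apply Rlt_le, Rinv_0_lt_compat.
  - rewrite (rsum_ext _ (fun m => INR m * Z m ^ 2)).
    + apply (rsum_m_sqr_rsum_sin_le b _ omega shift c d H t D N); try easy.
      * intros p Hp. unfold b.
        assert (Hln : 0 <= ln (INR N)).
        { rewrite <- ln_1. apply ln_le; [lra|]. apply INR_ge1; lia. }
        destruct (middle D N p); [|rewrite Rabs_R0; apply Rmult_le_pos; lra].
        destruct (prime_dec (Z.of_nat p)) as [Hpp|Hpp].
        -- rewrite Rabs_mult, (Rabs_pos_eq (lp p)), Rmult_comm by apply lp_nonneg.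
           apply Rmult_le_compat; [apply Rabs_pos|apply lp_nonneg|now apply Hx|now apply lp_le_ln].
        -- rewrite lp_not_prime, Rmult_0_l, Rabs_R0 by easy. apply Rmult_le_pos; lra.
      * intros p Em. unfold b. now rewrite Em.
    + intros m Hm. rewrite Rpow_mult_distr, pow2_sqrt by apply pos_INR.
      now rewrite RPow_abs, Rabs_pos_eq by apply pow2_ge_0.
Qed.

Lemma middle_form_rsum (x y a : nat -> R) (v : nat -> nat -> R) (K D N : nat) :
  middle_form x y (fun n => rsum (fun k => a k * v k n) K) D N
  = rsum (fun k => a k * middle_form x y (v k) D N) K.
Proof.
  unfold middle_form.
  rewrite (rsum_ext (fun k => a k * _) (fun k => rsum (fun p => a k * (if middle D N p
    then lp p * x p * rsum (fun m => y m * v k (p * m)%nat) (N / p) else 0)) N))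
    by (intros; now rewrite rsum_scal).
  rewrite rsum_swap. apply rsum_ext. intros p _. destruct (middle D N p).
  - rewrite (rsum_ext (fun m => y m * _) (fun m => rsum (fun k => a k * (y m * v k (p * m)%nat)) K)).
    2:{ intros m _. rewrite <- rsum_scal. apply rsum_ext. intros; ring. }
    rewrite rsum_swap, <- rsum_scal. apply rsum_ext. intros k _. rewrite rsum_scal. ring.
  - rewrite (rsum_ext _ (fun _ => 0)), rsum_0; [easy|]. intros; ring.
Qed.

Lemma middle_form_plus (x y u v : nat -> R) (D N : nat) :
  middle_form x y (fun n => u n + v n) D N = middle_form x y u D N + middle_form x y v D N.
Proof.
  unfold middle_form. rewrite <- rsum_plus. apply rsum_ext. intros p _.
  destruct (middle D N p); [|ring].
  rewrite <- Rmult_plus_distr_l, <- rsum_plus. f_equal. apply rsum_ext. intros; ring.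
Qed.

Lemma middle_form_minus (x y u v : nat -> R) (D N : nat) :
  middle_form x y (fun n => u n - v n) D N = middle_form x y u D N - middle_form x y v D N.
Proof.
  unfold middle_form. rewrite <- rsum_minus. apply rsum_ext. intros p _.
  destruct (middle D N p); [|ring].
  rewrite <- Rmult_minus_distr_l, <- rsum_minus. f_equal. apply rsum_ext. intros; ring.
Qed.

(** The k-th harmonic has frequency k omega; reading n there as kn for omega costs k^t <= K^t, so
    one constant serves all harmonics. *)
Lemma diophantine_scal (omega c : R) (t k K : nat) :
  0 <= c -> (1 <= k <= K)%nat -> diophantine omega c t ->
  diophantine (INR k * omega) (c / INR K ^ t) t.
Proof.
  intros Hc Hk H n j Hn. pose proof (INR_ge1 k ltac:(lia)) as Hk1.
  assert (HkK : INR k <= INR K) by (apply le_INR; lia).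
  assert (HK : 0 < INR K ^ t) by (apply pow_lt; lra).
  specialize (H (k * n)%nat j ltac:(nia)). rewrite mult_INR, Rpow_mult_distr in H.
  replace (omega * (INR k * INR n)) with (INR k * omega * INR n) in H by ring.
  apply Rmult_le_reg_r with (INR K ^ t); [easy|].
  unfold Rdiv. rewrite Rmult_assoc, Rinv_l, Rmult_1_r by lra.
  eapply Rle_trans; [exact H|].
  rewrite (Rmult_comm (INR k ^ t)), <- Rmult_assoc. apply Rmult_le_compat_l.
  - apply Rmult_le_pos; [apply Rabs_pos|]. apply pow_le, pos_INR.
  - apply pow_incr. lra.
Qed.

(** * Choice of parameters *)

(* With L of size log N, K = saw_degree, H = sieve_gap and D = cutoff: the degree K
   makes the truncation error of the sawtooth O(1/L) outside a set of O(N/L^4)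
   integers, H = K^2 L^4 makes each of the K harmonics O(N/K), and D makes
   H <= d D for the spacing d = c / (2 (K H)^t). *)
Definition saw_degree (t L : nat) : nat := (L ^ (8 * t + 1))%nat.

Lemma rsum_sqr_saw_error_le (omega c shift : R) (t L N : nat) :
  0 < c -> diophantine omega c t -> (1 <= L)%nat -> INR L ^ 4 <= 4096 * INR N ->
  rsum (fun n => (saw (omega * INR n + shift)
      - sawpoly (saw_degree t L) (omega * INR n + shift)) ^ 2) N
  <= (4097 * (8 * INR t + 3) ^ 2 + 16 / c ^ 4) * INR N / INR L ^ 2.
Proof.
  intros Hc Hdio HL HN. pose proof (INR_ge1 L HL) as HL1. pose proof (pos_INR t) as Ht.
  assert (Hpow : forall k, 0 < INR L ^ k) by (intros; apply pow_lt; lra).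
  (* Chosen so that 2 d (L^4)^t = c: bad points are then L^4 apart. The exponent 8t + 1 of the
     degree makes K d^2 = c^2 L / 4, hence an error O(1/L) elsewhere. *)
  set (d := c / (2 * INR L ^ (4 * t))).
  assert (Hd : 0 < d).
  { apply Rdiv_lt_0_compat; [easy|]. specialize (Hpow (4 * t)%nat). lra. }
  assert (HK : (1 <= saw_degree t L)%nat).
  { unfold saw_degree. pose proof (Nat.pow_nonzero L (8 * t + 1)). lia. }
  assert (HKR : INR (saw_degree t L) = INR L ^ (8 * t) * INR L).
  { unfold saw_degree. rewrite pow_INR, pow_add. ring. }
  assert (Hbig : harm (saw_degree t L) + 1 / 2 <= (8 * INR t + 3) * INR L).
  { pose proof (harm_le _ HK) as H1. unfold saw_degree in H1 at 2.
    rewrite pow_INR, ln_pow in H1 by lra.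
    pose proof (ln_le_self (INR L) ltac:(lra)).
    rewrite plus_INR, mult_INR in H1. replace (INR 8) with 8 in H1 by (simpl; ring).
    change (INR 1) with 1 in H1. nra. }
  apply Rle_trans with (rsum (fun n => ((8 * INR t + 3) * INR L) ^ 2
     * indR (~ away d (omega * INR n + shift)) + 16 / c ^ 4 / INR L ^ 2) N).
  - apply rsum_le. intros n _. unfold indR.
    assert (H0 : 0 < 16 / c ^ 4 / INR L ^ 2).
    { apply Rdiv_lt_0_compat; [|easy]. apply Rdiv_lt_0_compat; [lra|now apply pow_lt]. }
    rewrite <- (Rabs_pos_eq (_ ^ 2)) by apply pow2_ge_0. rewrite <- RPow_abs.
    set (e := saw _ - sawpoly _ _).
    destruct excluded_middle_informative as [Hn|Hn].
    + assert (Rabs e <= (8 * INR t + 3) * INR L).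
      { unfold e. eapply Rle_trans; [apply Rabs_triang|]. rewrite Rabs_Ropp.
        pose proof (saw_le (omega * INR n + shift)).
        pose proof (sawpoly_le (saw_degree t L) (omega * INR n + shift)). lra. }
      pose proof (pow_incr (Rabs e) _ 2 (conj (Rabs_pos e) H)). lra.
    + apply NNPP in Hn. pose proof (sawpoly_approx _ _ d HK Hd Hn) as H1. fold e in H1.
      rewrite HKR in H1.
      assert (E : / (INR L ^ (8 * t) * INR L * d ^ 2) = 4 / (c ^ 2 * INR L)).
      { unfold d. replace (8 * t)%nat with (4 * t + 4 * t)%nat by lia. rewrite pow_add.
        specialize (Hpow (4 * t)%nat). field. lra. }
      rewrite E in H1.
      pose proof (pow_incr (Rabs e) _ 2 (conj (Rabs_pos e) H1)) as H2.
      replace ((4 / (c ^ 2 * INR L)) ^ 2) with (16 / c ^ 4 / INR L ^ 2) in H2 by (field; lra).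
      lra.
  - rewrite rsum_plus, rsum_scal, rsum_const.
    pose proof (count_not_away omega c d shift (INR L ^ 4) t N Hc (Hpow _) Hd) as H1.
    rewrite <- pow_mult in H1.
    specialize (H1 ltac:(right; unfold d; specialize (Hpow (4 * t)%nat); field; lra) Hdio).
    replace ((4097 * (8 * INR t + 3) ^ 2 + 16 / c ^ 4) * INR N / INR L ^ 2)
      with (((8 * INR t + 3) * INR L) ^ 2 * (4097 * INR N / INR L ^ 4)
            + 16 / c ^ 4 / INR L ^ 2 * INR N) by (field; lra).
    apply Rplus_le_compat_r, Rmult_le_compat_l; [apply pow2_ge_0|].
    eapply Rle_trans; [exact H1|].
    (* Absorbs the 1 in 1 + N/L^4, which accounts for 4097. *)
    assert (1 <= 4096 * INR N / INR L ^ 4).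
    { apply Rmult_le_reg_r with (INR L ^ 4); [easy|]. unfold Rdiv.
      rewrite Rmult_assoc, Rinv_l; [lra|]. specialize (Hpow 4%nat). lra. }
    unfold Rdiv in *. lra.
Qed.

Definition sieve_gap (t L : nat) : nat := (saw_degree t L ^ 2 * L ^ 4)%nat.

Definition cutoff (D0 t L : nat) : nat :=
  (D0 * (sieve_gap t L ^ S t * saw_degree t L ^ t))%nat.

Lemma middle_form_saw_le (A omega c shift : R) (g x y : nat -> R) (t D0 L N : nat) :
  0 < c <= 1 -> diophantine omega c t -> 2 / c <= INR D0 -> (1 <= N)%nat ->
  (1 <= L)%nat -> INR L ^ 4 <= 4096 * INR N -> ln (INR N) <= INR L -> 1 <= A ->
  (forall N, rsum (fun n => g n ^ 2) N <= A ^ 2 * INR N) ->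
  (forall p, nprime p -> Rabs (x p) <= A) -> (forall m, Rabs (y m) <= g m) ->
  Rabs (middle_form x y (fun n => saw (omega * INR n + shift)) (cutoff D0 t L) N)
  <= (8 * A ^ 2 + A / 2 * (8 * A ^ 2 + (4097 * (8 * INR t + 3) ^ 2 + 16 / c ^ 4))) * INR N.
Proof.
  intros Hc Hdio HD0 HN1 HL HN HlnN HA Hg Hx Hy.
  set (D := cutoff D0 t L). set (K := saw_degree t L). set (H := INR (sieve_gap t L)).
  set (Ce := 4097 * (8 * INR t + 3) ^ 2 + 16 / c ^ 4).
  pose proof (INR_ge1 L HL) as HL1. pose proof (INR_ge1 N HN1) as HN1R.
  assert (HK : (1 <= K)%nat).
  { unfold K, saw_degree. pose proof (Nat.pow_nonzero L (8 * t + 1)). lia. }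
  pose proof (INR_ge1 K HK) as HK1.
  assert (HHE : H = INR K ^ 2 * INR L ^ 4) by (unfold H, sieve_gap; now rewrite mult_INR, !pow_INR).
  assert (HH : 1 <= H).
  { rewrite HHE. pose proof (pow_R1_Rle (INR K) 2 HK1). pose proof (pow_R1_Rle (INR L) 4 HL1). nra. }
  assert (Hln : 0 <= ln (INR N)) by (rewrite <- ln_1; apply ln_le; lra).
  assert (Hharm : harm N <= 2 * INR L) by (pose proof (harm_le N HN1); lra).
  assert (Hharm0 : 0 <= harm N).
  { apply rsum_nonneg. intros n Hn. pose proof (INR_ge1 n ltac:(lia)).
    apply Rlt_le, Rinv_0_lt_compat. lra. }
  assert (HKt : 1 <= INR K ^ t) by now apply pow_R1_Rle.
  assert (HHt : 1 <= H ^ t) by now apply pow_R1_Rle.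
  assert (HA2 : 0 <= A ^ 2) by apply pow2_ge_0.
  set (P := fun n => sawpoly K (omega * INR n + shift)).
  set (e := fun n => saw (omega * INR n + shift) - sawpoly K (omega * INR n + shift)).
  assert (E : middle_form x y (fun n => saw (omega * INR n + shift)) D N
     = middle_form x y P D N + middle_form x y e D N).
  { rewrite <- middle_form_plus. unfold middle_form. apply rsum_ext. intros p _.
    destruct (middle D N p); [|easy]. f_equal. apply rsum_ext. intros m _. unfold P, e. ring. }
  assert (BP : Rabs (middle_form x y P D N) <= 8 * A ^ 2 * INR N).
  { unfold P, sawpoly. rewrite middle_form_rsum.
    apply Rle_trans with (rsum (fun _ => 8 * A ^ 2 * INR N / INR K) K).
    2:{ rewrite rsum_const. right. field. lra. }
    apply rsum_Rabs_le. intros k Hk. rewrite Rabs_mult.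
    pose proof (INR_ge1 k ltac:(lia)) as Hk1. pose proof PI2_3_2.
    assert (Hpk : 0 < / (PI * INR k) <= 1).
    { assert (1 <= PI * INR k) by nra. split; [apply Rinv_0_lt_compat; lra|].
      rewrite <- Rinv_1. apply Rinv_le_contravar; lra. }
    rewrite (Rabs_pos_eq (/ _)) by lra.
    enough (Rabs (middle_form x y (fun n => sin (2 * PI * INR k * (omega * INR n + shift))) D N)
       <= 8 * A ^ 2 * INR N / INR K) as HB.
    { pose proof (Rabs_pos (middle_form x y (fun n => sin (2 * PI * INR k * (omega * INR n + shift))) D N)).
      nra. }
    replace (middle_form x y (fun n => sin (2 * PI * INR k * (omega * INR n + shift))) D N)
      with (middle_form x y (fun n => sin (2 * PI * (INR k * omega * INR n + INR k * shift))) D N).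
    2:{ unfold middle_form. apply rsum_ext. intros p _. destruct (middle D N p); [|easy].
        f_equal. apply rsum_ext. intros m _. do 2 f_equal. ring. }
    (* With H = K^2 L^4 the two terms become 2 A^2 N/K and 14 A^2 N/K, half of whose sum is 8 A^2
       N/K; the K harmonics then total 8 A^2 N even with each coefficient bounded by 1. *)
    set (l := INR N / (INR K * INR L)).
    assert (Hl : 0 < l) by (apply Rdiv_lt_0_compat; nra).
    assert (Hd : 0 < c / (2 * (INR K ^ t * H ^ t)) <= 1).
    { split; [apply Rdiv_lt_0_compat; nra|]. apply Rmult_le_reg_r with (2 * (INR K ^ t * H ^ t)); [nra|].
      unfold Rdiv. rewrite Rmult_assoc, Rinv_l by nra. nra. }
    eapply Rle_trans; [apply (middle_form_sin_le A l (INR k * omega) (INR k * shift)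
      (c / INR K ^ t) (c / (2 * (INR K ^ t * H ^ t))) H g x y t D N); try easy|].
    - apply Rdiv_lt_0_compat; lra.
    - lra.
    - right. field. lra.
    - apply diophantine_scal; [lra|easy|easy].
    - unfold D, cutoff. rewrite !mult_INR, !pow_INR. fold H K.
      replace (c / (2 * (INR K ^ t * H ^ t)) * (INR D0 * (H ^ S t * INR K ^ t)))
        with (H * (c * INR D0 / 2)) by (simpl; field; lra).
      assert (2 <= c * INR D0).
      { apply Rmult_le_compat_l with (r := c) in HD0; [|lra].
        replace (c * (2 / c)) with 2 in HD0 by (field; lra). lra. }
      nra.
    - apply Rle_trans with ((l * (A ^ 2 * (2 * INR L))
        + / l * (7 * (A * INR L) ^ 2 * INR N ^ 2 * (2 * INR L) / H)) / 2).
      + apply Rmult_le_compat_r; [lra|].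
        pose proof (Rinv_0_lt_compat l Hl). pose proof (Rinv_0_lt_compat H ltac:(lra)).
        apply Rplus_le_compat; apply Rmult_le_compat_l; try lra.
        * apply Rmult_le_compat_l; easy.
        * unfold Rdiv. apply Rmult_le_compat_r; [lra|].
          assert (Hsq : (A * ln (INR N)) ^ 2 <= (A * INR L) ^ 2).
          { apply pow_incr. split; [apply Rmult_le_pos; lra|apply Rmult_le_compat_l; lra]. }
          pose proof (pow2_ge_0 (A * ln (INR N))). pose proof (pow2_ge_0 (INR N)).
          apply Rmult_le_compat; [|easy| |easy].
          -- apply Rmult_le_pos; lra.
          -- apply Rmult_le_compat_r; lra.
      + right. rewrite HHE. unfold l. field. lra. }
  assert (Be : Rabs (middle_form x y e D N) <= A / 2 * (8 * A ^ 2 + Ce) * INR N).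
  (* l = 1/L cancels the factor L of [harm N] in one term; in the other, L ln N <= L^2 meets the
     mean square O(N / L^2). *)
  { eapply Rle_trans; [apply (middle_form_error_le A (/ INR L) g x y e D N); try easy|].
    - apply Rinv_0_lt_compat; lra.
    - pose proof (rsum_sqr_saw_error_le omega c shift t L N ltac:(lra) Hdio HL HN) as H1.
      fold K e Ce in H1. fold e. rewrite Rinv_inv, (Rmult_assoc (A / 2)), (Rmult_plus_distr_r (8 * A ^ 2)).
      apply Rmult_le_compat_l; [lra|].
      assert (He0 : 0 <= rsum (fun n => e n ^ 2) N) by (apply rsum_nonneg; intros; apply pow2_ge_0).
      apply Rplus_le_compat.
      + apply Rle_trans with (/ INR L * (4 * A ^ 2 * INR N * (2 * INR L))).
        * apply Rmult_le_compat_l; [apply Rlt_le, Rinv_0_lt_compat; lra|].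
          apply Rmult_le_compat_l; [nra|easy].
        * right. field. lra.
      + apply Rle_trans with (INR L * (INR L * (Ce * INR N / INR L ^ 2))).
        * apply Rmult_le_compat_l; [lra|]. apply Rmult_le_compat; easy.
        * right. field. lra. }
  rewrite E. eapply Rle_trans; [apply Rabs_triang|]. fold Ce. lra.
Qed.

(** Rests on exp(-1/8) >= 7/8 and (7/8)^8 > 1/3. The consequence ln 3 > 1 makes ln ln N positive
    from N = 3 on. *)
Lemma exp_1_lt_3 : exp 1 < 3.
Proof.
  assert (H : 7 / 8 <= exp (- (1 / 8))) by (pose proof (exp_ineq1_le (- (1 / 8))); lra).
  assert (E : exp (-1) = exp (- (1 / 8)) ^ 8).
  { rewrite <- Rpower_pow by apply exp_pos. unfold Rpower. rewrite ln_exp. f_equal.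
    replace (INR 8) with 8 by (simpl; ring). field. }
  pose proof (pow_incr (7 / 8) (exp (- (1 / 8))) 8 ltac:(lra)) as H1. rewrite <- E in H1.
  assert (E2 : exp 1 * exp (-1) = 1) by (rewrite <- exp_plus; replace (1 + -1) with 0 by ring; apply exp_0).
  pose proof (exp_pos 1). assert (1 / 3 < exp (-1)) by lra. nra.
Qed.

Lemma ln_3_gt_1 : 1 < ln 3.
Proof.
  rewrite <- (ln_exp 1). apply ln_increasing; [apply exp_pos|apply exp_1_lt_3].
Qed.

(** Fourth power of y <= exp y at y = ln x / 4. With L <= 2 ln N it yields L^4 <= 4096 N. *)
Lemma ln_pow4_le (x : R) : 1 <= x -> ln x ^ 4 <= 256 * x.
Proof.
  intros Hx. assert (H0 : 0 <= ln x) by (rewrite <- ln_1; apply ln_le; lra).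
  pose proof (exp_ineq1_le (ln x / 4)) as H.
  assert (E : x = exp (ln x / 4) ^ 4).
  { rewrite <- Rpower_pow by apply exp_pos. unfold Rpower. rewrite ln_exp.
    replace (INR 4 * (ln x / 4)) with (ln x) by (simpl; field). now rewrite exp_ln by lra. }
  rewrite E at 2.
  pose proof (pow_incr (ln x / 4) (exp (ln x / 4)) 4 ltac:(lra)) as H1.
  replace ((ln x / 4) ^ 4) with (ln x ^ 4 / 256) in H1 by field. lra.
Qed.

Lemma nat_between (x : R) : 1 <= x -> exists L, (1 <= L)%nat /\ x <= INR L <= 2 * x.
Proof.
  intros Hx. destruct (archimed x) as [H1 H2].
  exists (Z.to_nat (up x)).
  assert (H : (1 < up x)%Z) by (apply lt_IZR; lra).
  split; [lia|]. rewrite INR_IZR_INZ, Z2Nat.id by lia. lra.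
Qed.

Definition cutoff_exponent (t : nat) : nat := ((16 * t + 6) * S t + (8 * t + 1) * t)%nat.

Lemma cutoff_eq (D0 t L : nat) : cutoff D0 t L = (D0 * L ^ cutoff_exponent t)%nat.
Proof.
  unfold cutoff, sieve_gap, saw_degree, cutoff_exponent. f_equal.
  rewrite <- !Nat.pow_mul_r, <- Nat.pow_add_r, <- !Nat.pow_mul_r, <- Nat.pow_add_r.
  f_equal. ring.
Qed.

(** C is fixed before the shifts and the function, which is the uniformity in [beta] and f. Its part
    4 [Cm] comes from two middle forms with two sawtooths each. *)
Lemma saw_difference_sum_le (A omega c : R) (t : nat) :
  1 <= A -> 0 < c <= 1 -> diophantine omega c t ->
  exists C, 0 < C /\ forall (s1 s2 : R) (w g x1 x2 y1 y2 : nat -> R) (N : nat),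
    bilinear_split A w g x1 x2 y1 y2 -> (27 <= N)%nat ->
    Rabs (rsum (fun n => w n * (saw (omega * INR n + s1) - saw (omega * INR n + s2))) N)
    <= C * (INR N * ln (ln (INR N)) / ln (INR N)).
Proof.
  intros HA Hc Hdio.
  destruct (nat_between (2 / c)) as [D0 [HD0 [HD0c _]]].
  { apply Rmult_le_reg_r with c; [lra|]. unfold Rdiv. rewrite Rmult_assoc, Rinv_l; lra. }
  set (Cm := 8 * A ^ 2 + A / 2 * (8 * A ^ 2 + (4097 * (8 * INR t + 3) ^ 2 + 16 / c ^ 4))).
  set (Cd := 1 + ln (INR D0) + 2 * INR (cutoff_exponent t)).
  assert (HlnD0 : 0 <= ln (INR D0)) by (rewrite <- ln_1; apply ln_le; [lra|now apply INR_ge1]).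
  assert (HCm : 0 < Cm).
  { unfold Cm. assert (0 < 16 / c ^ 4) by (apply Rdiv_lt_0_compat; [lra|apply pow_lt; lra]).
    pose proof (pow2_ge_0 (8 * INR t + 3)). nra. }
  assert (HCd : 0 < Cd) by (unfold Cd; pose proof (pos_INR (cutoff_exponent t)); lra).
  assert (HCl : 0 < log_const A).
  { unfold log_const. pose proof (pow2_ge_0 A). nra. }
  exists (log_const A + 16 * A ^ 2 * Cd + 4 * Cm). split; [nra|].
  intros s1 s2 w g x1 x2 y1 y2 N Hb HN.
  set (u := fun n => saw (omega * INR n + s1) - saw (omega * INR n + s2)).
  assert (HNR : 27 <= INR N) by (apply le_INR in HN; simpl in HN; lra).
  pose proof ln_3_gt_1 as Hln3. pose proof exp_1_lt_3 as He.
  (* 27 = 3^3 and ln 3 > 1 give ln N >= 3 and ln ln N >= 1, so every O(N) term is also O(N ln ln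
     N). *)
  assert (HlnN : 3 <= ln (INR N)).
  { apply Rle_trans with (ln 27); [|apply ln_le; lra].
    replace 27 with (3 ^ 3) by ring. rewrite ln_pow by lra. simpl. lra. }
  assert (HllN : 1 <= ln (ln (INR N))).
  { apply Rle_trans with (ln 3); [lra|]. apply ln_le; lra. }
  destruct (nat_between (ln (INR N))) as [L [HL HLb]]; [lra|].
  assert (HL1 : 1 <= INR L) by now apply INR_ge1.
  assert (HL4 : INR L ^ 4 <= 4096 * INR N).
  { pose proof (ln_pow4_le (INR N) ltac:(lra)).
    pose proof (pow_incr (INR L) (2 * ln (INR N)) 4 ltac:(lra)) as H1.
    rewrite Rpow_mult_distr in H1. lra. }
  assert (Hu : forall n, Rabs (u n) <= 1).
  { intros n. unfold u. eapply Rle_trans; [apply Rabs_triang|]. rewrite Rabs_Ropp.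
    pose proof (saw_le (omega * INR n + s1)). pose proof (saw_le (omega * INR n + s2)). lra. }
  set (D := cutoff D0 t L).
  assert (Hmid : forall x y, (forall p, nprime p -> Rabs (x p) <= A) ->
     (forall m, Rabs (y m) <= g m) -> Rabs (middle_form x y u D N) <= 2 * Cm * INR N).
  { intros x y Hx Hy. unfold u. rewrite middle_form_minus.
    eapply Rle_trans; [apply Rabs_triang|]. rewrite Rabs_Ropp.
    pose proof (bs_sqr _ _ _ _ _ _ _ Hb) as Hg.
    pose proof (middle_form_saw_le A omega c s1 g x y t D0 L N Hc Hdio HD0c ltac:(lia) HL HL4
      ltac:(lra) HA Hg Hx Hy) as M1.
    pose proof (middle_form_saw_le A omega c s2 g x y t D0 L N Hc Hdio HD0c ltac:(lia) HL HL4
      ltac:(lra) HA Hg Hx Hy) as M2.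
    fold D Cm in M1, M2. lra. }
  assert (HharmD : harm D <= Cd * ln (ln (INR N))).
  { assert (HLs : (1 <= L ^ cutoff_exponent t)%nat) by (pose proof (Nat.pow_nonzero L (cutoff_exponent t)); lia).
    assert (HD1 : (1 <= D)%nat) by (unfold D; rewrite cutoff_eq; nia).
    pose proof (harm_le D HD1) as H1. unfold D in H1 at 2.
    pose proof (INR_ge1 D0 HD0).
    rewrite cutoff_eq, mult_INR, pow_INR, ln_mult, ln_pow in H1 by (try apply pow_lt; lra).
    assert (HlnL : ln (INR L) <= 2 * ln (ln (INR N))).
    { apply Rle_trans with (ln (2 * ln (INR N))); [apply ln_le; lra|].
      rewrite ln_mult by lra. pose proof (ln_le_self 2 ltac:(lra)). lra. }
    pose proof (pos_INR (cutoff_exponent t)). unfold Cd. nra. }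
  pose proof (log_weighted_sum A w g x1 x2 y1 y2 u N Hb Hu) as B1.
  pose proof (bilinear_form_middle A w g x1 x2 y1 y2 u D N Hb Hu) as B2.
  pose proof (Hmid x1 y1 (bs_x1 _ _ _ _ _ _ _ Hb) (bs_y1 _ _ _ _ _ _ _ Hb)) as B3.
  pose proof (Hmid x2 y2 (bs_x2 _ _ _ _ _ _ _ Hb) (bs_y2 _ _ _ _ _ _ _ Hb)) as B4.
  set (S := rsum (fun n => w n * u n) N) in *.
  set (ll := ln (ln (INR N))) in *. set (l := ln (INR N)) in *.
  assert (HS : Rabs (l * S) <= (log_const A + 16 * A ^ 2 * Cd + 4 * Cm) * (INR N * ll)).
  { set (BF := bilinear_form x1 x2 y1 y2 u N) in *.
    set (M1 := middle_form x1 y1 u D N) in *. set (M2 := middle_form x2 y2 u D N) in *.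
    replace (l * S) with ((l * S - BF) + (BF - (M1 + M2)) + M1 + M2) by ring.
    eapply Rle_trans; [apply Rabs_triang|]. eapply Rle_trans; [apply Rplus_le_compat_r, Rabs_triang|].
    eapply Rle_trans; [apply Rplus_le_compat_r, Rplus_le_compat_r, Rabs_triang|].
    assert (HA2 : 0 <= 16 * A ^ 2 * INR N) by (pose proof (pow2_ge_0 A); nra).
    assert (16 * A ^ 2 * INR N * harm D <= 16 * A ^ 2 * INR N * (Cd * ll))
      by (apply Rmult_le_compat_l; easy).
    assert (INR N <= INR N * ll) by nra.
    assert (log_const A * INR N <= log_const A * (INR N * ll)) by (apply Rmult_le_compat_l; lra).
    assert (Cm * INR N <= Cm * (INR N * ll)) by (apply Rmult_le_compat_l; lra).
    lra. }
  rewrite Rabs_mult, (Rabs_pos_eq l) in HS by lra.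
  apply Rmult_le_reg_l with l; [lra|]. eapply Rle_trans; [exact HS|].
  right. field. lra.
Qed.

(** * Beatty sequences *)

Lemma dist_nint_le (x : R) (j : Z) : dist_nint x <= Rabs (x - IZR j).
Proof.
  unfold dist_nint. pose proof (base_Int_part x) as [H1 H2].
  destruct (Z_le_gt_dec j (Int_part x)) as [H|H].
  - apply IZR_le in H. eapply Rle_trans; [apply Rmin_l|]. rewrite Rabs_pos_eq; lra.
  - assert (H3 : (Int_part x + 1 <= j)%Z) by lia. apply IZR_le in H3. rewrite plus_IZR in H3.
    eapply Rle_trans; [apply Rmin_r|]. rewrite Rabs_left1; lra.
Qed.

Lemma dist_nint_pos (alpha : R) (n : nat) :
  irrational alpha -> (1 <= n)%nat -> 0 < dist_nint (alpha * INR n).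
Proof.
  intros Hirr Hn. unfold dist_nint. set (x := alpha * INR n).
  pose proof (base_Int_part x) as [H1 H2]. apply Rmin_glb_lt; [|lra].
  destruct (Rle_lt_or_eq_dec _ _ H1) as [H|H]; [lra|exfalso].
  apply (Hirr (Int_part x) (Z.of_nat n)); [lia|].
  rewrite H, <- INR_IZR_INZ. unfold x. pose proof (INR_ge1 n Hn). field. lra.
Qed.

Lemma positive_lower_bound (u : nat -> R) (N : nat) :
  (forall n, (1 <= n)%nat -> 0 < u n) ->
  exists m, 0 < m /\ forall n, (1 <= n < N)%nat -> m <= u n.
Proof.
  intros Hu. induction N as [|N [m [Hm H]]].
  - exists 1. split; [lra|lia].
  - destruct (Nat.eq_dec N 0) as [->|HN]; [exists 1; split; [lra|lia]|].
    exists (Rmin m (u N)). split; [apply Rmin_glb_lt; [easy|apply Hu; lia]|].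
    intros n Hn. destruct (Nat.eq_dec n N) as [->|Hne]; [apply Rmin_r|].
    eapply Rle_trans; [apply Rmin_l|]. apply H. lia.
Qed.

(** Take an integer t > T. Every n^t ||alpha n|| is positive; were their infimum 0, arbitrarily
    small values would occur beyond any N, the liminf would be 0 and t <= T would follow. *)
Lemma finite_type_diophantine (alpha : R) :
  irrational alpha -> finite_type alpha ->
  exists c t, 0 < c /\ diophantine alpha c t.
Proof.
  intros Hirr [T HT].
  destruct (nat_between (Rmax 1 (T + 1)) (Rmax_l _ _)) as [t [_ [Ht _]]].
  pose proof (Rmax_r 1 (T + 1)) as HTt.
  set (u := fun n : nat => Rpower (INR n) (INR t) * dist_nint (alpha * INR n)).
  assert (Hu : forall n, (1 <= n)%nat -> 0 < u n).
  { intros n Hn. apply Rmult_lt_0_compat; [apply exp_pos|now apply dist_nint_pos]. }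
  destruct (classic (exists c, 0 < c /\ forall n, (1 <= n)%nat -> c <= u n)) as [[c [Hc H]]|H].
  - exists c, t. split; [easy|]. intros n j Hn. eapply Rle_trans; [now apply (H n)|].
    unfold u. pose proof (INR_ge1 n Hn). rewrite Rpower_pow, Rmult_comm by lra.
    apply Rmult_le_compat_r; [apply pow_le; lra|apply dist_nint_le].
  - exfalso. enough (liminf_zero alpha (INR t)) as Hl by (apply HT in Hl; lra).
    apply is_LimInf_seq_unique. intros eps. fold u. split.
    + intros N. destruct (positive_lower_bound u N Hu) as [m [Hm Hmu]].
      assert (H1 : exists n, (1 <= n)%nat /\ u n < Rmin m eps).
      { apply NNPP. intros Hn. apply H. exists (Rmin m eps).
        split; [apply Rmin_glb_lt; [easy|apply cond_pos]|]. intros n Hn1.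
        apply Rnot_lt_le. intros Hlt. apply Hn. now exists n. }
      destruct H1 as [n [Hn1 Hn2]]. exists n. split.
      * destruct (le_lt_dec N n) as [|Hlt]; [easy|]. specialize (Hmu n (conj Hn1 Hlt)).
        pose proof (Rmin_l m eps). lra.
      * pose proof (Rmin_r m eps). rewrite Rplus_0_l. fold (u n). lra.
    + exists 1%nat. intros n Hn. pose proof (Hu n Hn). pose proof (cond_pos eps).
      fold (u n). lra.
Qed.

(** If n/alpha is within 1/alpha of an integer m, then |alpha m - n| is alpha times that distance
    and m <= 2n, so the bound for alpha at m transfers; otherwise 1/alpha itself is a lower bound.
    Capping c' by 1 later keeps the spacing d below 1. *)
Lemma diophantine_inv (alpha c : R) (t : nat) :
  1 < alpha -> 0 < c -> diophantine alpha c t ->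
  exists c', 0 < c' <= 1 /\ diophantine (- / alpha) c' t.
Proof.
  intros Ha Hc H. assert (Hw : 0 < / alpha < 1).
  { split; [apply Rinv_0_lt_compat; lra|]. rewrite <- Rinv_1. apply Rinv_lt_contravar; lra. }
  assert (H2t : 0 < 2 ^ t) by (apply pow_lt; lra).
  set (c1 := c / (2 ^ t * alpha)).
  assert (Hc1 : 0 < c1) by (apply Rdiv_lt_0_compat; nra).
  exists (Rmin (/ alpha) c1). split.
  { split; [apply Rmin_glb_lt; lra|]. eapply Rle_trans; [apply Rmin_l|lra]. }
  intros n j Hn. pose proof (INR_ge1 n Hn) as Hn1.
  assert (Hnt : 1 <= INR n ^ t) by now apply pow_R1_Rle.
  set (dd := Rabs (- / alpha * INR n - IZR j)).
  assert (Hdd0 : 0 <= dd) by apply Rabs_pos.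
  assert (Hdd1 : / alpha <= dd -> Rmin (/ alpha) c1 <= dd * INR n ^ t).
  { intros H1. eapply Rle_trans; [apply Rmin_l|]. nra. }
  destruct (Rle_lt_dec (/ alpha) dd) as [H1|H1]; [now apply Hdd1|].
  assert (Hj : (j < 0)%Z).
  { apply lt_IZR. unfold dd in H1. apply Rabs_def2 in H1. nra. }
  set (m := Z.to_nat (- j)).
  assert (Hm : INR m = - IZR j) by (unfold m; rewrite INR_IZR_INZ, Z2Nat.id, opp_IZR by lia; easy).
  pose proof (H m (Z.of_nat n) ltac:(lia)) as H2. rewrite <- INR_IZR_INZ in H2.
  assert (E : Rabs (alpha * INR m - INR n) = alpha * dd).
  { unfold dd. rewrite <- (Rabs_pos_eq alpha) at 2 by lra. rewrite <- Rabs_mult. f_equal.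
    rewrite Hm. field. lra. }
  rewrite E in H2.
  assert (Hm2 : INR m <= 2 * INR n).
  { rewrite Hm. unfold dd in H1. apply Rabs_def2 in H1. nra. }
  assert (Hmt : INR m ^ t <= 2 ^ t * INR n ^ t).
  { rewrite <- Rpow_mult_distr. apply pow_incr. split; [apply pos_INR|easy]. }
  eapply Rle_trans; [apply Rmin_r|]. unfold c1.
  apply Rmult_le_reg_r with (2 ^ t * alpha); [nra|].
  unfold Rdiv. rewrite Rmult_assoc, Rinv_l by nra. rewrite Rmult_1_r.
  eapply Rle_trans; [exact H2|].
  replace (dd * INR n ^ t * (2 ^ t * alpha)) with (alpha * dd * (2 ^ t * INR n ^ t)) by ring.
  apply Rmult_le_compat_l; [nra|easy].
Qed.

(* Both sides count the integers in the half-open interval (x - 1/alpha, x],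
   where x = (beta - n)/alpha. *)
Lemma indic_Beatty (alpha beta : R) (n : nat) :
  1 < alpha -> (1 <= n)%nat ->
  indic (in_Beatty alpha beta n)
  = RtoC (/ alpha + (saw (- / alpha * INR n + / alpha * beta)
                     - saw (- / alpha * INR n + (/ alpha * beta - / alpha)))).
Proof.
  intros Ha Hn. assert (Hw : 0 < / alpha < 1).
  { split; [apply Rinv_0_lt_compat; lra|]. rewrite <- Rinv_1. apply Rinv_lt_contravar; lra. }
  set (x1 := - / alpha * INR n + / alpha * beta).
  set (x2 := - / alpha * INR n + (/ alpha * beta - / alpha)).
  assert (Ex : x2 = x1 - / alpha) by (unfold x1, x2; ring).
  assert (En : INR n = beta - alpha * x1) by (unfold x1; field; lra).
  pose proof (base_Int_part x1) as [A1 A2]. pose proof (base_Int_part x2) as [B1 B2].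
  assert (E : / alpha + (saw x1 - saw x2) = IZR (Int_part x1 - Int_part x2)).
  { unfold saw, fpart. rewrite minus_IZR, Ex at 1. lra. }
  rewrite E. clear E.
  assert (Hle : (Int_part x2 <= Int_part x1)%Z).
  { apply Z.lt_succ_r, lt_IZR. rewrite succ_IZR. lra. }
  assert (Hge : (Int_part x1 <= Int_part x2 + 1)%Z).
  { apply Z.lt_succ_r, lt_IZR. rewrite succ_IZR, plus_IZR. lra. }
  unfold indic. destruct excluded_middle_informative as [[_ [m Hm]]|Hno].
  - pose proof (base_Int_part (alpha * IZR m + beta)) as [C1 C2].
    rewrite <- Hm, <- INR_IZR_INZ, En in C1, C2.
    assert (D1 : - x1 <= IZR m).
    { apply Rmult_le_reg_l with alpha; lra. }
    assert (D2 : IZR m < - x2).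
    { rewrite Ex. apply Rmult_lt_reg_l with alpha; [lra|].
      replace (alpha * - (x1 - / alpha)) with (1 - alpha * x1) by (field; lra). lra. }
    assert (E1 : (Int_part x2 < - m)%Z) by (apply lt_IZR; rewrite opp_IZR; lra).
    assert (E2 : (- m < Int_part x1 + 1)%Z) by (apply lt_IZR; rewrite opp_IZR, plus_IZR; lra).
    replace (Int_part x1 - Int_part x2)%Z with 1%Z by lia. easy.
  - replace (Int_part x1 - Int_part x2)%Z with 0%Z; [easy|].
    destruct (Z.eq_dec (Int_part x1) (Int_part x2)) as [->|Hne]; [lia|exfalso].
    (* The integer in the interval (x2, x1] is the floor of x1, and its opposite is the index m. As
       [saw] is 1/2 at integers, the identity stays exact at the endpoints. *)
    apply Hno. split; [easy|]. exists (- Int_part x1)%Z.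
    assert (E1 : Int_part x1 = (Int_part x2 + 1)%Z) by lia.
    assert (D1 : x2 < IZR (Int_part x1)) by (rewrite E1, plus_IZR; lra).
    set (r := alpha * IZR (- Int_part x1) + beta).
    pose proof (base_Int_part r) as [C1 C2].
    assert (R1 : INR n <= r).
    { unfold r. rewrite En, opp_IZR. nra. }
    assert (R2 : r < INR n + 1).
    { unfold r. rewrite En, opp_IZR.
      assert (alpha * (x1 - / alpha) < alpha * IZR (Int_part x1))
        by (apply Rmult_lt_compat_l; lra).
      replace (alpha * (x1 - / alpha)) with (alpha * x1 - 1) in H by (field; lra). lra. }
    rewrite INR_IZR_INZ in R1, R2.
    assert (Z.of_nat n < Int_part r + 1)%Z by (apply lt_IZR; rewrite plus_IZR; lra).
    assert (Int_part r < Z.of_nat n + 1)%Z by (apply lt_IZR; rewrite plus_IZR; lra).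
    lia.
Qed.

(** * Reduction to real and imaginary parts, and conclusion *)

Lemma Re_csum (h : nat -> C) (N : nat) : Re (csum h N) = rsum (fun n => Re (h n)) N.
Proof. induction N as [|N IH]; [easy|]. simpl. now rewrite <- IH. Qed.

Lemma Im_csum (h : nat -> C) (N : nat) : Im (csum h N) = rsum (fun n => Im (h n)) N.
Proof. induction N as [|N IH]; [easy|]. simpl. now rewrite <- IH. Qed.

Lemma Cmod_le_Re_Im (z : C) : Cmod z <= Rabs (Re z) + Rabs (Im z).
Proof.
  pose proof (Rabs_pos (Re z)). pose proof (Rabs_pos (Im z)).
  unfold Cmod. rewrite <- (sqrt_square (Rabs (Re z) + Rabs (Im z))) by lra.
  apply sqrt_le_1_alt. destruct z as [a b]. simpl in *.
  pose proof (Rsqr_abs a) as E1. pose proof (Rsqr_abs b) as E2. unfold Rsqr in *. nra.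
Qed.

Lemma Rabs_Re_le (z : C) : Rabs (Re z) <= Cmod z.
Proof. eapply Rle_trans; [apply Rmax_l|apply Rmax_Cmod]. Qed.

Lemma Rabs_Im_le (z : C) : Rabs (Im z) <= Cmod z.
Proof. eapply Rle_trans; [apply Rmax_r|apply Rmax_Cmod]. Qed.

(** Re(zw) = Re z Re w - Im z Im w dictates the four functions; the sign is carried by the factor at
    the prime. *)
Lemma bilinear_split_Re (A : R) (f : nat -> C) :
  1 <= A -> in_FA A f ->
  bilinear_split A (fun n => Re (f n)) (fun n => Cmod (f n))
    (fun n => Re (f n)) (fun n => - Im (f n)) (fun n => Re (f n)) (fun n => Im (f n)).
Proof.
  intros HA [[_ Hm] [Hp Hsq]]. split; try easy.
  - intros n. apply Rabs_Re_le.
  - intros p Hpp. eapply Rle_trans; [apply Rabs_Re_le|now apply Hp].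
  - intros p Hpp. rewrite Rabs_Ropp. eapply Rle_trans; [apply Rabs_Im_le|now apply Hp].
  - intros n. apply Rabs_Re_le.
  - intros n. apply Rabs_Im_le.
  - intros p m Hpp Hm1 Hd. pose proof (nprime_ge2 p Hpp).
    rewrite Hm by (lia || now apply nprime_coprime). unfold Re, Im. simpl. ring.
Qed.

Lemma bilinear_split_Im (A : R) (f : nat -> C) :
  1 <= A -> in_FA A f ->
  bilinear_split A (fun n => Im (f n)) (fun n => Cmod (f n))
    (fun n => Re (f n)) (fun n => Im (f n)) (fun n => Im (f n)) (fun n => Re (f n)).
Proof.
  intros HA [[_ Hm] [Hp Hsq]]. split; try easy.
  - intros n. apply Rabs_Im_le.
  - intros p Hpp. eapply Rle_trans; [apply Rabs_Re_le|now apply Hp].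
  - intros p Hpp. eapply Rle_trans; [apply Rabs_Im_le|now apply Hp].
  - intros n. apply Rabs_Im_le.
  - intros n. apply Rabs_Re_le.
  - intros p m Hpp Hm1 Hd. pose proof (nprime_ge2 p Hpp).
    rewrite Hm by (lia || now apply nprime_coprime). unfold Re, Im. simpl. ring.
Qed.

Lemma Cmod_Beatty_error_le (alpha beta : R) (f : nat -> C) (N : nat) :
  1 < alpha ->
  Cmod (csum (fun n => (indic (in_Beatty alpha beta n) * f n)%C) N
        - (/ alpha)%R * csum f N)%C
  <= Rabs (rsum (fun n => Re (f n) * (saw (- / alpha * INR n + / alpha * beta)
       - saw (- / alpha * INR n + (/ alpha * beta - / alpha)))) N)
   + Rabs (rsum (fun n => Im (f n) * (saw (- / alpha * INR n + / alpha * beta)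
       - saw (- / alpha * INR n + (/ alpha * beta - / alpha)))) N).
Proof.
  intros Ha. eapply Rle_trans; [apply Cmod_le_Re_Im|].
  set (z := (csum _ N - _)%C).
  assert (E1 : Re z = Re (csum (fun n => (indic (in_Beatty alpha beta n) * f n)%C) N)
     - / alpha * Re (csum f N)) by (unfold z, Re, Im; simpl; ring).
  assert (E2 : Im z = Im (csum (fun n => (indic (in_Beatty alpha beta n) * f n)%C) N)
     - / alpha * Im (csum f N)) by (unfold z, Re, Im; simpl; ring).
  rewrite E1, E2, !Re_csum, !Im_csum, <- !rsum_scal, <- !rsum_minus.
  right. f_equal; f_equal; apply rsum_ext; intros n Hn; rewrite indic_Beatty by (easy || lia);
    unfold Re, Im; simpl; ring.
Qed.

Theorem theorem1 :
  forall (A alpha : R),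
    1 <= A -> 1 < alpha -> irrational alpha -> finite_type alpha ->
    exists K : R, 0 < K /\
      forall (beta : R) (f : nat -> C), in_FA A f ->
        forall N : nat, (3 <= N)%nat ->
          Cmod (csum (fun n => (indic (in_Beatty alpha beta n) * f n)%C) N
                - (/ alpha)%R * csum f N)%C
          <= K * (INR N * ln (ln (INR N)) / ln (INR N)).
Proof.
  intros A alpha HA Ha Hirr Hft.
  destruct (finite_type_diophantine alpha Hirr Hft) as [c0 [t [Hc0 Hd0]]].
  destruct (diophantine_inv alpha c0 t Ha Hc0 Hd0) as [c [Hc Hdio]].
  destruct (saw_difference_sum_le A (- / alpha) c t HA Hc Hdio) as [C1 [HC1 Hlarge]].
  pose proof ln_3_gt_1 as Hln3.
  assert (Hll3 : 0 < ln (ln 3)) by (rewrite <- ln_1; apply ln_increasing; lra).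
  assert (Hln27 : 0 < ln 27) by (rewrite <- ln_1; apply ln_increasing; lra).
  (* Covers 3 <= N < 27, where the trivial bound A N is compared with the error term through ln ln N
     >= ln ln 3 and ln N <= ln 27. The factor 2 in the final constant counts the real and imaginary
     parts. *)
  set (C2 := A * ln 27 / ln (ln 3)).
  assert (HC2 : 0 < C2) by (apply Rdiv_lt_0_compat; nra).
  exists (2 * (C1 + C2)). split; [lra|]. intros beta f Hf N HN.
  eapply Rle_trans; [now apply Cmod_Beatty_error_le|].
  assert (HN3 : 3 <= INR N) by (apply le_INR in HN; simpl in HN; lra).
  assert (HlnN : ln 3 <= ln (INR N)) by (apply ln_le; lra).
  assert (HllN : ln (ln 3) <= ln (ln (INR N))) by (apply ln_le; lra).
  assert (HX : 0 < INR N * ln (ln (INR N)) / ln (INR N)) by (apply Rdiv_lt_0_compat; nra).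
  pose proof (bilinear_split_Re A f HA Hf) as HRe.
  pose proof (bilinear_split_Im A f HA Hf) as HIm.
  destruct (le_lt_dec 27 N) as [HN27|HN27].
  - pose proof (Hlarge (/ alpha * beta) (/ alpha * beta - / alpha) _ _ _ _ _ _ N HRe HN27) as T1.
    pose proof (Hlarge (/ alpha * beta) (/ alpha * beta - / alpha) _ _ _ _ _ _ N HIm HN27) as T2.
    cbv beta in T1, T2. set (X := INR N * _ / _) in *.
    apply (Rmult_lt_0_compat _ _ HC2) in HX. lra.
  - set (S := fun n => saw (- / alpha * INR n + / alpha * beta)
      - saw (- / alpha * INR n + (/ alpha * beta - / alpha))).
    assert (HS : forall n, Rabs (S n) <= 1).
    { intros n. unfold S. eapply Rle_trans; [apply Rabs_triang|]. rewrite Rabs_Ropp.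
      pose proof (saw_le (- / alpha * INR n + / alpha * beta)).
      pose proof (saw_le (- / alpha * INR n + (/ alpha * beta - / alpha))). lra. }
    assert (Htriv : forall w, (forall n, Rabs (w n) <= Cmod (f n)) ->
      Rabs (rsum (fun n => w n * S n) N) <= A * INR N).
    { intros w Hw. apply Rle_trans with (rsum (fun n => Cmod (f n)) N).
      - apply rsum_Rabs_le. intros n _. rewrite Rabs_mult.
        pose proof (HS n). pose proof (Hw n). pose proof (Rabs_pos (w n)).
        pose proof (Rabs_pos (S n)). nra.
      - apply rsum_g_le; [lra|]. apply Hf. }
    pose proof (Htriv _ (bs_w _ _ _ _ _ _ _ HRe)) as T1.
    pose proof (Htriv _ (bs_w _ _ _ _ _ _ _ HIm)) as T2.
    assert (Hlow : A * INR N <= C2 * (INR N * ln (ln (INR N)) / ln (INR N))).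
    { assert (HN27' : INR N <= 27) by (apply Nat.lt_le_incl, le_INR in HN27; simpl in HN27; lra).
      assert (HlnN27 : ln (INR N) <= ln 27) by (apply ln_le; lra).
      unfold C2. apply Rmult_le_reg_r with (ln (ln 3) * ln (INR N)); [nra|].
      replace (A * ln 27 / ln (ln 3) * (INR N * ln (ln (INR N)) / ln (INR N)) * (ln (ln 3) * ln (INR N)))
        with (A * INR N * (ln (ln (INR N)) * ln 27)) by (field; lra).
      apply Rmult_le_compat_l; [nra|]. apply Rmult_le_compat; lra. }
    cbv beta in T1, T2. fold S. set (X := INR N * _ / _) in *.
    apply (Rmult_lt_0_compat _ _ HC1) in HX. unfold S in *. lra.
Qed.
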